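(* Let $\theta\neq 0$ and $\kappa$ be fixed complex numbers and $r\neq 0$ a real number with $\theta r+\kappa\neq 0$. If coefficients $b_n(\theta,\kappa,r)$ ($n\ge1$) satisfy $$G(z+1)\sim A^{-1}z^{-\frac{1}{2}z^2-\frac{1}{2}z-\frac{1}{12}}e^{\frac{z^2}{4}}\bigl(\Gamma(z+1)\bigr)^z\left(1+\sum_{n\geq 1}\frac{b_n(\theta,\kappa,r)}{z^{2n}}\right)^{\frac{1}{\theta r+\kappa}}$$ as $z\to+\infty$, $|\arg z|<\pi$, then $$b_n(\theta,\kappa,r)\sim(-1)^n\frac{2(\theta r+\kappa)(2n-1)!}{(2\pi)^{2n+2}}\quad\text{as } n\to+\infty.$$
   Context: $G$ is the Barnes $G$-function ($G(z+1)=\Gamma(z)G(z)$, $G(1)=1$); $A$ is the Glaisher–Kinkelin constant, $\log A=\frac1{12}-\zeta'(-1)$; principal branches are used for all logarithms and powers, $(\Gamma(z+1))^z=\exp(z\log\Gamma(z+1))$. The expansion in $z$ is meant in the Poincaré sense: for every $N\ge1$ the ratio of $G(z+1)$ to the displayed prefactor equals $\bigl(1+\sum_{n=1}^{N-1}b_n z^{-2n}+\mathcal{O}(z^{-2N})\bigr)^{1/(\theta r+\kappa)}$. *)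

(* Defs.v *)
From Stdlib Require Import Reals ClassicalEpsilon.
From Coquelicot Require Import Coquelicot.
Open Scope R_scope.
Open Scope C_scope.

Definition Cexp (z : C) : C :=
  (exp (Re z) * cos (Im z), exp (Re z) * sin (Im z))%R.

(* Principal argument: values in (-PI, PI] for z <> 0, and PI on the negative
   reals; the value at 0 is irrelevant. *)
Definition Carg (z : C) : R :=
  (if Rlt_dec (Im z) 0 then - acos (Re z / Cmod z) else acos (Re z / Cmod z))%R.

Definition Clog (z : C) : C := (ln (Cmod z), Carg z).

Definition Cpower (z w : C) : C := Cexp (w * Clog z).

(* Total limit of a sequence; meaningful only when the sequence converges. *)
Definition Clim_seq (u : nat -> C) : C :=
  lim (T := C_CompleteNormedModule) (filtermap u eventually).

(* a 1 * ... * a n *)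
Fixpoint Cprod1 (a : nat -> C) (n : nat) : C :=
  match n with
  | O => 1
  | S m => Cprod1 a m * a n
  end.

(* a 1 + ... + a n, equal to 0 when n = 0 *)
Definition Csum1 (a : nat -> C) (n : nat) : C :=
  sum_n_m (G := C_AbelianMonoid) a 1 n.

Definition euler_gamma : R :=
  real (Lim_seq (fun n => (sum_n_m (fun k => / INR k) 1 n - ln (INR n))%R)).

(* The principal branch of log Gamma: the branch that is holomorphic on the
   plane cut along (-oo, 0] and real on the positive reals, obtained by taking
   principal logarithms termwise in the Weierstrass product
     1 / Gamma z = z e^(gamma z) prod_(k >= 1) (1 + z/k) e^(-z/k).
   Off the real axis it differs in general from Clog (Gamma z) by a multiple
   of 2 i PI. *)
Definition log_Gamma (z : C) : C :=
  - RtoC euler_gamma * z - Clog z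
  + Clim_seq (Csum1 (fun k => z / INR k - Clog (1 + z / INR k))).

(* The functional equation G (z + 1) = Gamma z * G z with G 1 = 1 does not
   determine G by itself; the Barnes function is the entire solution given by
     G (w + 1) = (2 PI)^(w/2) e^(-(w + (1 + gamma) w^2)/2)
                 prod_(k >= 1) (1 + w/k)^k e^(w^2/(2k) - w). *)
Definition Barnes_G (z : C) : C :=
  let w := z - 1 in
  Cpower (RtoC (2 * PI)) (w / 2)
  * Cexp (- (w + (1 + RtoC euler_gamma) * w ^ 2) / 2)
  * Clim_seq (Cprod1 (fun k =>
      (1 + w / INR k) ^ k * Cexp (w ^ 2 / (2 * INR k) - w))).

(* f is the analytic continuation of sum_(n >= 1) n^(-s) to C minus {1}; its
   value at 1 is unconstrained. *)
Definition is_zeta (f : C -> C) : Prop :=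
  (forall s : C, s <> 1 ->
     ex_derive (K := C_AbsRing) (V := C_NormedModule) f s) /\
  (forall s : C, (1 < Re s)%R ->
     is_series (K := C_AbsRing) (V := C_NormedModule)
       (fun n => Cpower (INR (S n)) (- s)) (f s)).

Definition zeta : C -> C :=
  epsilon (inhabits (fun _ : C => RtoC 0)) is_zeta.

Definition glaisher : C := Cexp (1 / 12 - C_derive zeta (- (1))).

Definition prefactor (z : C) : C :=
  / glaisher
  * Cpower z (- (1 / 2) * z ^ 2 - 1 / 2 * z - 1 / 12)
  * Cexp (z ^ 2 / 4)
  * Cexp (z * log_Gamma (z + 1)).

(* G (z + 1) ~ prefactor z * (1 + sum_(n >= 1) b n / z^(2n))^p in the Poincare
   sense as z -> oo in |arg z| < PI, i.e. uniformly in each closed subsector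
   |arg z| <= PI - delta.  The error term E sits inside the power. *)
Definition Barnes_expansion (p : C) (b : nat -> C) : Prop :=
  forall (N : nat) (delta : R), (1 <= N)%nat -> (0 < delta < PI)%R ->
  exists (E : C -> C) (K rho : R), (0 < rho)%R /\
  forall z : C, (rho <= Cmod z)%R -> (Rabs (Carg z) <= PI - delta)%R ->
    (Cmod (E z) <= K / Cmod z ^ (2 * N))%R /\
    Barnes_G (z + 1) / prefactor z
    = Cpower (1 + Csum1 (fun n => b n / z ^ (2 * n)) (N - 1) + E z) p.

(* Main.v *)
(** At a positive integer [z = m] the ratio [G (m + 1) / prefactor m] is
    [glaisher * exp (log_ratio m)], and the recurrences of [Gamma] and [G] give
      [log_ratio (m + 1) - log_ratio m = c + 1/2 int_0^1 B_2 x / (m + x) dx].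
    The hypothesis makes the ratio tend to [1]; this forces [c = 0] and the value of
    [glaisher], so neither Stirling's constant nor any property of zeta is needed.
    Inserting the Fourier series of the Bernoulli polynomial [B_2] and integrating by
    parts identifies the asymptotic series of the logarithm of the ratio:
      [sum a_n / m^(2n)] with [a_n = (-1)^n 2 (2n-1)! sum_k (2 pi k)^(-2n-2)].
    By the hypothesis [1 + sum b_n x^n] is then the formal exponential of [q sum a_n x^n],
    where [q = theta r + kappa], so [n b_n = q sum_j j a_j b_(n-j)]; as the [a_n] grow
    factorially, the term [j = n] dominates and [b_n ~ q a_n]. *)

Require Import Defs.
From Stdlib Require Import Reals Factorial Lra Lia Arith Wf_nat.
From Coquelicot Require Import Coquelicot.
Open Scope R_scope.

(** * Finite sums and the Fourier series of the second Bernoulli polynomial *)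

(** Integers suffice because an expansion in powers of m^(-2) has its coefficients determined along
    any sequence tending to infinity; there every factor of the Weierstrass products is a positive
    real. B_2 appears because the coefficient of ln ((m + 1) / m) in a step of the logarithm is B_2
    (- m) / 2. Its Fourier series serves two purposes: the boundary terms of the integrations by
    parts are differences between m + 1 and m, hence telescope, and the sum over k displays the size
    of a_n, since k = 1 gives the claimed leading term and k >= 2 a relative error of order 4^(-n).
    Partial sums up to K are integrated and K tends to infinity afterwards, so no series is
    exchanged with an integral. The delicate point is the complex exponent: the hypothesis describes
    W^p while the coefficients belong to W, so the power must be inverted on the principal branch,
    and the phase of [glaisher] must be shown trivial first. Complex series are carried as pairs of
    real sequences, with q = u + i v, so that the mean value theorem and real derivatives apply. *)

Fixpoint sum1 (u : nat -> R) (n : nat) : R :=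
  match n with O => 0 | S m => sum1 u m + u (S m) end.

Lemma sum1_S (u : nat -> R) n : sum1 u (S n) = sum1 u n + u (S n).
Proof. reflexivity. Qed.

Lemma sum1_ext (u v : nat -> R) n :
  (forall k, (1 <= k <= n)%nat -> u k = v k) -> sum1 u n = sum1 v n.
Proof.
induction n as [|n IH]; simpl; intros H; trivial.
rewrite IH, H; trivial; try lia. intros; apply H; lia.
Qed.

Lemma sum1_plus (u v : nat -> R) n :
  sum1 (fun k => u k + v k) n = sum1 u n + sum1 v n.
Proof. induction n as [|n IH]; simpl; [ring|rewrite IH; ring]. Qed.

Lemma sum1_scal (a : R) (u : nat -> R) n :
  sum1 (fun k => a * u k) n = a * sum1 u n.
Proof. induction n as [|n IH]; simpl; [ring|rewrite IH; ring]. Qed.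

Lemma sum1_Rabs_le (u v : nat -> R) n :
  (forall k, (1 <= k <= n)%nat -> Rabs (u k) <= v k) ->
  Rabs (sum1 u n) <= sum1 v n.
Proof.
induction n as [|n IH]; simpl; intros H.
- rewrite Rabs_R0; lra.
- eapply Rle_trans; [apply Rabs_triang|].
  apply Rplus_le_compat; [apply IH; intros; apply H|apply H]; lia.
Qed.

(** Telescoping comparison: 1 / (L + 1)^2 <= 1 / (L (L + 1)) = 1 / L - 1 / (L + 1). *)
Lemma sum1_tail (u : nat -> R) (C : R) (K L : nat) :
  (forall k, (K < k)%nat -> Rabs (u k) <= C / INR k ^ 2) -> (1 <= K <= L)%nat ->
  Rabs (sum1 u L - sum1 u K) <= C * (/ INR K - / INR L).
Proof.
intros Hu [HK HL]. induction HL as [|L HL IH].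
- rewrite Rminus_diag, Rabs_R0. lra.
- rewrite ?sum1_S.
  replace (sum1 u L + u (S L) - sum1 u K) with ((sum1 u L - sum1 u K) + u (S L)) by ring.
  eapply Rle_trans; [apply Rabs_triang|].
  assert (HSL : (K < S L)%nat) by lia.
  pose proof (Hu _ HSL) as H1.
  assert (HL0 : 0 < INR L) by (apply lt_0_INR; lia).
  assert (HC : 0 <= C).
  { assert (0 <= C / INR (S L) ^ 2) by (eapply Rle_trans; [apply Rabs_pos|exact H1]).
    assert (0 < INR (S L) ^ 2) by (apply pow_lt, lt_0_INR; lia).
    replace C with (C / INR (S L) ^ 2 * INR (S L) ^ 2) by (field; apply not_0_INR; lia).
    apply Rmult_le_pos; lra. }
  assert (C / INR (S L) ^ 2 <= C * (/ INR L - / INR (S L))).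
  { unfold Rdiv. apply Rmult_le_compat_l; trivial. rewrite S_INR.
    replace (/ INR L - / (INR L + 1)) with (/ (INR L * (INR L + 1))) by (field; lra).
    apply Rinv_le_contravar; nra. }
  lra.
Qed.

Lemma sum1_tail_le (u : nat -> R) (C : R) (K L : nat) : 0 <= C ->
  (forall k, (K < k)%nat -> Rabs (u k) <= C / INR k ^ 2) -> (1 <= K <= L)%nat ->
  Rabs (sum1 u L - sum1 u K) <= C / INR K.
Proof.
intros HC Hu HKL. eapply Rle_trans; [apply (sum1_tail u C K L); trivial|].
apply Rmult_le_compat_l; trivial.
assert (0 < / INR L) by (apply Rinv_0_lt_compat, lt_0_INR; lia). lra.
Qed.

Lemma is_lim_seq_div_INR (C : R) : is_lim_seq (fun n => C / INR n) 0.
Proof.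
replace (Finite 0) with (Rbar_mult C 0) by (simpl; f_equal; ring).
apply is_lim_seq_scal_l.
replace (Finite 0) with (Rbar_inv p_infty) by reflexivity.
apply is_lim_seq_inv; [apply is_lim_seq_INR|discriminate].
Qed.

Lemma sum1_ex_lim (u : nat -> R) (C : R) :
  (forall k, (1 <= k)%nat -> Rabs (u k) <= C / INR k ^ 2) ->
  ex_finite_lim_seq (sum1 u).
Proof.
intros Hu. apply ex_lim_seq_cauchy_corr.
assert (HC : 0 <= C).
{ pose proof (Hu 1%nat (le_n _)) as H. simpl in H.
  pose proof (Rabs_pos (u 1%nat)). lra. }
intros eps.
pose proof (is_lim_seq_div_INR C) as Hl.
apply is_lim_seq_spec in Hl. destruct (Hl (pos_div_2 eps)) as [N HN].
exists (S N). intros n m Hn Hm.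
assert (HN1 := HN (S N) ltac:(lia)). rewrite Rminus_0_r in HN1.
apply Rabs_lt_between in HN1. change (pos (pos_div_2 eps)) with (eps / 2) in HN1.
pose proof (sum1_tail_le u C (S N) n HC ltac:(intros; apply Hu; lia) ltac:(lia)) as H1.
pose proof (sum1_tail_le u C (S N) m HC ltac:(intros; apply Hu; lia) ltac:(lia)) as H2.
replace (sum1 u n - sum1 u m) with ((sum1 u n - sum1 u (S N)) - (sum1 u m - sum1 u (S N))) by ring.
eapply Rle_lt_trans; [apply Rabs_triang|]. rewrite Rabs_Ropp. lra.
Qed.

(** * The Fourier remainder of B_2 *)

Definition freq (k : nat) : R := 2 * PI * INR k.

(** B_2 minus its K-th Fourier partial sum. The two primed functions below are its first and second
    derivatives; the second is twice the Dirichlet kernel. *)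
Definition fourier_rem (K : nat) (x : R) : R :=
  x ^ 2 - x + 1 / 6 - sum1 (fun k => 4 / freq k ^ 2 * cos (freq k * x)) K.

Definition fourier_rem' (K : nat) (x : R) : R :=
  2 * x - 1 + sum1 (fun k => 4 / freq k * sin (freq k * x)) K.

Definition fourier_rem'' (K : nat) (x : R) : R :=
  2 + 4 * sum1 (fun k => cos (freq k * x)) K.

Lemma is_derive_eq (f : R -> R) (x l l' : R) :
  is_derive f x l -> l = l' -> is_derive f x l'.
Proof. intros H <-; exact H. Qed.

Lemma is_derive_Rext (f g : R -> R) (x l : R) :
  (forall t, f t = g t) -> is_derive f x l -> is_derive g x l.
Proof. exact (is_derive_ext (K := R_AbsRing) (V := R_NormedModule) f g x l). Qed.

Lemma is_derive_Rplus (f g : R -> R) (x l l' : R) :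
  is_derive f x l -> is_derive g x l' -> is_derive (fun t => f t + g t) x (l + l').
Proof. exact (is_derive_plus (K := R_AbsRing) (V := R_NormedModule) f g x l l'). Qed.

Lemma is_derive_Rminus (f g : R -> R) (x l l' : R) :
  is_derive f x l -> is_derive g x l' -> is_derive (fun t => f t - g t) x (l - l').
Proof. exact (is_derive_minus (K := R_AbsRing) (V := R_NormedModule) f g x l l'). Qed.

Lemma freq_pos k : (1 <= k)%nat -> 0 < freq k.
Proof.
intros H. unfold freq. pose proof PI_RGT_0.
assert (0 < INR k) by (apply lt_0_INR; lia).
apply Rmult_lt_0_compat; lra.
Qed.

Lemma freq_ge k : (1 <= k)%nat -> 2 * INR k <= freq k.
Proof.
intros H. unfold freq. pose proof PI2_1.
assert (0 < INR k) by (apply lt_0_INR; lia). nra.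
Qed.

Lemma sin_freq k : sin (freq k) = 0.
Proof.
apply sin_eq_0_1. exists (2 * Z.of_nat k)%Z.
rewrite mult_IZR, <- INR_IZR_INZ. unfold freq. ring.
Qed.

Lemma cos_freq k : cos (freq k) = 1.
Proof.
unfold freq. replace (2 * PI * INR k) with (0 + 2 * INR k * PI) by ring.
rewrite cos_period. apply cos_0.
Qed.

Lemma sin_freq_half k : sin (freq k * (1 / 2)) = 0.
Proof.
apply sin_eq_0_1. exists (Z.of_nat k)%Z.
rewrite <- INR_IZR_INZ. unfold freq. field.
Qed.

(** Each step adds 4 sin a cos b = 2 sin (b + a) - 2 sin (b - a), so the sum telescopes. The product
    form avoids dividing by sin (pi t). *)
Lemma dirichlet_kernel K t :
  sin (PI * t) * fourier_rem'' K t = 2 * sin ((2 * INR K + 1) * PI * t).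
Proof.
unfold fourier_rem''. induction K as [|K IH].
- simpl. replace ((2 * 0 + 1) * PI * t) with (PI * t) by ring. ring.
- transitivity (sin (PI * t) * (2 + 4 * sum1 (fun k => cos (freq k * t)) K)
                + 4 * sin (PI * t) * cos (freq (S K) * t)); [rewrite ?sum1_S; ring|].
  rewrite IH.
  unfold freq. rewrite S_INR.
  replace ((2 * (INR K + 1) + 1) * PI * t) with (2 * PI * (INR K + 1) * t + PI * t) by ring.
  replace ((2 * INR K + 1) * PI * t) with (2 * PI * (INR K + 1) * t - PI * t) by ring.
  rewrite sin_plus, sin_minus. ring.
Qed.

Lemma is_derive_fourier_rem K x : is_derive (fourier_rem K) x (fourier_rem' K x).
Proof.
induction K as [|K IH].
- unfold fourier_rem, fourier_rem'; simpl. auto_derive; trivial; ring.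
- apply (is_derive_Rext (fun x => fourier_rem K x - 4 / freq (S K) ^ 2 * cos (freq (S K) * x))).
  { intros t. unfold fourier_rem. rewrite ?sum1_S. ring. }
  apply is_derive_eq with (fourier_rem' K x - - (4 / freq (S K) * sin (freq (S K) * x))).
  2:{ unfold fourier_rem'; rewrite ?sum1_S. ring. }
  apply is_derive_Rminus; trivial.
  auto_derive; trivial.
  assert (freq (S K) <> 0) by (apply Rgt_not_eq, freq_pos; lia). field; trivial.
Qed.

Lemma is_derive_fourier_rem' K x : is_derive (fourier_rem' K) x (fourier_rem'' K x).
Proof.
induction K as [|K IH].
- unfold fourier_rem', fourier_rem''; simpl. auto_derive; trivial; ring.
- apply (is_derive_Rext (fun x => fourier_rem' K x + 4 / freq (S K) * sin (freq (S K) * x))).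
  { intros t. unfold fourier_rem'. rewrite ?sum1_S. ring. }
  apply is_derive_eq with (fourier_rem'' K x + 4 * cos (freq (S K) * x)).
  2:{ unfold fourier_rem''; rewrite ?sum1_S. ring. }
  apply is_derive_Rplus; trivial.
  auto_derive; trivial.
  assert (freq (S K) <> 0) by (apply Rgt_not_eq, freq_pos; lia). field; trivial.
Qed.

(** This and [cos_half_odd] are why 1/2 is the base point: there both the first-order Taylor term
    and the boundary term of the integration by parts vanish. *)
Lemma fourier_rem'_half K : fourier_rem' K (1 / 2) = 0.
Proof.
unfold fourier_rem'. rewrite (sum1_ext _ (fun _ => 0 * 0)), sum1_scal; [lra|].
intros k _. rewrite sin_freq_half; ring.
Qed.

Lemma cos_half_odd K : cos ((2 * INR K + 1) * PI * (1 / 2)) = 0.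
Proof.
apply cos_eq_0_1. exists (Z.of_nat K). rewrite <- INR_IZR_INZ. field.
Qed.

(** Since sin (pi y) = cos (pi |y - 1/2|), the sine decreases with the distance to 1/2. This keeps
    the denominators away from 0 between 1/2 and x. *)
Lemma sin_PI_ge x t : 0 < x < 1 -> Rabs (t - 1 / 2) <= Rabs (x - 1 / 2) ->
  sin (PI * x) <= sin (PI * t).
Proof.
intros Hx Ht.
assert (H : forall y, sin (PI * y) = cos (PI * Rabs (y - 1 / 2))).
{ intros y. replace (PI * y) with (PI / 2 + PI * (y - 1 / 2)) by field.
  rewrite <- cos_sin. unfold Rabs. destruct Rcase_abs; trivial.
  rewrite <- cos_neg. f_equal; ring. }
rewrite 2!H. pose proof PI_RGT_0.
assert (Rabs (x - 1 / 2) <= 1 / 2) by (apply Rabs_le; lra).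
pose proof (Rabs_pos (t - 1 / 2)). apply cos_decr_1; nra.
Qed.

(* Taylor's formula at 1/2 with the Dirichlet kernel as second derivative; [psi]
   absorbs one integration by parts, which gains the factor 1 / (2 K + 1). *)
Lemma fourier_rem_half_bound x : 0 < x < 1 -> exists C, forall K,
  Rabs (fourier_rem K x - fourier_rem K (1 / 2)) <= C / (2 * INR K + 1).
Proof.
intros Hx. pose proof PI_RGT_0 as HPI.
set (s := sin (PI * x)).
assert (Hs : 0 < s) by (apply sin_gt_0; nra).
exists (2 * (/ s + PI / s ^ 2) / PI). intros K.
set (w := (2 * INR K + 1) * PI).
assert (HK : 0 <= INR K) by apply pos_INR.
assert (Hw : 0 < w) by (unfold w; nra).
set (psi := fun t => fourier_rem K t + (x - t) * fourier_rem' K t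
                     + 2 * ((x - t) / sin (PI * t)) * (cos (w * t) / w)).
assert (Hpx : psi x = fourier_rem K x) by (unfold psi, Rdiv; ring).
assert (Hph : psi (1 / 2) = fourier_rem K (1 / 2)).
{ unfold psi. rewrite fourier_rem'_half. unfold w. rewrite cos_half_odd. unfold Rdiv. ring. }
rewrite <- Hpx, <- Hph.
(* In the derivative of [psi] the term (x - t) [fourier_rem'' K t], equal to 2 (x - t) sin (w t) /
   sin (pi t), cancels against the derivative of cos (w t) / w. What remains differentiates only (x
   - t) / sin (pi t) and keeps the factor 1 / w. *)
assert (Hb : Rabs (psi x - psi (1 / 2)) <= 2 * (/ s + PI / s ^ 2) / w * Rabs (x - 1 / 2)).
{ apply (bounded_variation psi (fun t => 2 * (- / sin (PI * t)
        - (x - t) * (PI * cos (PI * t)) / sin (PI * t) ^ 2) * (cos (w * t) / w))).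
  intros t Ht.
  assert (Hst : s <= sin (PI * t)) by (apply sin_PI_ge; trivial).
  assert (Hd : is_derive psi t (2 * (- / sin (PI * t) - (x - t) * (PI * cos (PI * t)) / sin (PI * t) ^ 2)
            * (cos (w * t) / w))).
  { unfold psi. auto_derive.
    - repeat split; try lra.
      + eexists; apply is_derive_fourier_rem.
      + eexists; apply is_derive_fourier_rem'.
    - change (Derive (fun x0 => fourier_rem K x0) t) with (Derive (fourier_rem K) t).
      change (Derive (fun x0 => fourier_rem' K x0) t) with (Derive (fourier_rem' K) t).
      rewrite (is_derive_unique _ _ _ (is_derive_fourier_rem K t)).
      rewrite (is_derive_unique _ _ _ (is_derive_fourier_rem' K t)).
      replace (fourier_rem'' K t) with (2 * sin (w * t) / sin (PI * t)).
      2:{ pose proof (dirichlet_kernel K t) as E. fold w in E. rewrite <- E. field. lra. }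
      field. split; lra. }
  split; [exact Hd|]. clear Hd.
  set (st := sin (PI * t)) in *.
  rewrite 2!Rabs_mult, (Rabs_right 2) by lra.
  assert (H1 : Rabs (cos (w * t) / w) <= / w).
  { unfold Rdiv. rewrite Rabs_mult, (Rabs_right (/ w)) by (apply Rle_ge, Rlt_le, Rinv_0_lt_compat, Hw).
    rewrite <- (Rmult_1_l (/ w)) at 2. apply Rmult_le_compat_r.
    apply Rlt_le, Rinv_0_lt_compat, Hw. apply Rabs_le, COS_bound. }
  assert (H2 : Rabs (- / st - (x - t) * (PI * cos (PI * t)) / st ^ 2) <= / s + PI / s ^ 2).
  { eapply Rle_trans; [apply Rabs_triang|]. rewrite 2!Rabs_Ropp.
    apply Rplus_le_compat.
    - rewrite Rabs_right by (apply Rle_ge, Rlt_le, Rinv_0_lt_compat; lra).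
      apply Rinv_le_contravar; lra.
    - unfold Rdiv. rewrite !Rabs_mult.
      rewrite (Rabs_right (/ st ^ 2)) by (apply Rle_ge, Rlt_le, Rinv_0_lt_compat, pow_lt; lra).
      rewrite (Rabs_right PI) by lra.
      assert (Rabs (x - t) <= 1).
      { replace (x - t) with ((x - 1 / 2) - (t - 1 / 2)) by ring.
        eapply Rle_trans; [apply Rabs_triang|]. rewrite Rabs_Ropp.
        assert (Rabs (x - 1 / 2) <= 1 / 2) by (apply Rabs_le; lra). lra. }
      assert (Rabs (cos (PI * t)) <= 1) by (apply Rabs_le, COS_bound).
      assert (/ st ^ 2 <= / s ^ 2) by (apply Rinv_le_contravar; [apply pow_lt; lra|apply pow_incr; lra]).
      assert (0 < / st ^ 2) by (apply Rinv_0_lt_compat, pow_lt; lra).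
      pose proof (Rabs_pos (x - t)). pose proof (Rabs_pos (cos (PI * t))).
      apply Rmult_le_compat; try lra.
      + apply Rmult_le_pos; try lra. apply Rmult_le_pos; lra.
      + apply Rle_trans with (1 * (PI * 1)); [|lra].
        apply Rmult_le_compat; try lra. apply Rmult_le_pos; lra.
        apply Rmult_le_compat; try lra. }
  unfold Rdiv. apply Rmult_le_compat; trivial; try apply Rabs_pos.
  - apply Rmult_le_pos; [lra|apply Rabs_pos].
  - lra. }
eapply Rle_trans; [apply Hb|].
assert (Rabs (x - 1 / 2) <= 1) by (apply Rabs_le; lra).
assert (0 <= 2 * (/ s + PI / s ^ 2) / w).
{ assert (0 < / s) by (apply Rinv_0_lt_compat; trivial).
  assert (0 < / s ^ 2) by (apply Rinv_0_lt_compat, pow_lt; trivial).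
  assert (0 < / w) by (apply Rinv_0_lt_compat; trivial).
  unfold Rdiv. apply Rmult_le_pos; [|lra]. nra. }
replace (2 * (/ s + PI / s ^ 2) / PI / (2 * INR K + 1)) with (2 * (/ s + PI / s ^ 2) / w * 1).
- apply Rmult_le_compat_l; trivial.
- unfold w. field. repeat split; lra.
Qed.

Lemma fourier_coeff_bound k x : (1 <= k)%nat ->
  Rabs (4 / freq k ^ 2 * cos (freq k * x)) <= 1 / INR k ^ 2.
Proof.
intros Hk. pose proof (freq_ge k Hk). assert (0 < INR k) by (apply lt_0_INR; lia).
rewrite Rabs_mult.
assert (H1 : Rabs (4 / freq k ^ 2) <= 1 / INR k ^ 2).
{ rewrite Rabs_right.
  2:{ apply Rle_ge, Rlt_le, Rdiv_lt_0_compat; [lra|apply pow_lt; lra]. }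
  replace (1 / INR k ^ 2) with (4 / (2 * INR k) ^ 2) by (field; lra).
  unfold Rdiv. apply Rmult_le_compat_l; [lra|].
  apply Rinv_le_contravar; [apply pow_lt; lra|apply pow_incr; lra]. }
assert (Rabs (cos (freq k * x)) <= 1) by (apply Rabs_le, COS_bound).
rewrite <- (Rmult_1_r (1 / INR k ^ 2)).
apply Rmult_le_compat; trivial; apply Rabs_pos.
Qed.

(** B_2 and all the cosines have mean zero; this later identifies the constant to which the
    remainders converge. *)
Lemma is_RInt_fourier_rem K : is_RInt (fourier_rem K) 0 1 0.
Proof.
set (F := fun x => x ^ 3 / 3 - x ^ 2 / 2 + x / 6
        - sum1 (fun k => 4 / freq k ^ 3 * sin (freq k * x)) K).
assert (HF : F 1 - F 0 = 0).
{ unfold F. rewrite 2!(sum1_ext (fun k => 4 / freq k ^ 3 * _) (fun _ => 0 * 0)), sum1_scal.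
  - lra.
  - intros k _. rewrite Rmult_0_r, sin_0. ring.
  - intros k _. rewrite Rmult_1_r, sin_freq. ring. }
cut (is_RInt (fourier_rem K) 0 1 (F 1 - F 0)); [rewrite HF; trivial|].
apply (is_RInt_derive (V := R_CompleteNormedModule)).
- intros x _. clear HF. unfold F, fourier_rem. induction K as [|K IH].
  + simpl. auto_derive; trivial; field.
  + rewrite sum1_S.
    apply (is_derive_Rext (fun x => x ^ 3 / 3 - x ^ 2 / 2 + x / 6
        - sum1 (fun k => 4 / freq k ^ 3 * sin (freq k * x)) K
        - 4 / freq (S K) ^ 3 * sin (freq (S K) * x))); [intros t; rewrite sum1_S; ring|].
    eapply is_derive_eq.
    2:{ instantiate (1 := x ^ 2 - x + 1 / 6 - sum1 (fun k => 4 / freq k ^ 2 * cos (freq k * x)) K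
          - 4 / freq (S K) ^ 2 * cos (freq (S K) * x)). ring. }
    apply is_derive_Rminus; trivial.
    auto_derive; trivial.
    assert (freq (S K) <> 0) by (apply Rgt_not_eq, freq_pos; lia). field; trivial.
- intros x _. apply (ex_derive_continuous (K := R_AbsRing) (V := R_NormedModule)). eexists. apply is_derive_fourier_rem.
Qed.

(** The remainders converge pointwise by absolute convergence; by [fourier_rem_half_bound] the limit
    [e] is the same at every x in (0, 1), and the tail of sum 1 / k^2 makes the convergence uniform
    with rate 1 / K. As every remainder has integral 0, [e] is 0. *)
Lemma fourier_rem_bound K x : (1 <= K)%nat -> 0 < x < 1 ->
  Rabs (fourier_rem K x) <= 2 / INR K.
Proof.
set (u := fun x k => 4 / freq k ^ 2 * cos (freq k * x)).
assert (Hlim : forall x, exists l, is_lim_seq (fun K => fourier_rem K x) (Finite l)).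
{ intros y. destruct (sum1_ex_lim (u y) 1) as [l Hl].
  - intros k Hk. apply fourier_coeff_bound; trivial.
  - exists (y ^ 2 - y + 1 / 6 - l). apply is_lim_seq_minus'; trivial. apply is_lim_seq_const. }
destruct (Hlim (1 / 2)) as [e He].
assert (Hx : forall x, 0 < x < 1 -> is_lim_seq (fun K => fourier_rem K x) e).
{ intros y Hy. destruct (fourier_rem_half_bound y Hy) as [C HC].
  assert (H0 : is_lim_seq (fun K => fourier_rem K y - fourier_rem K (1 / 2)) 0).
  { apply is_lim_seq_abs_0.
    apply (is_lim_seq_le_le_loc (fun _ => 0) _ (fun K => Rabs C / INR K)).
    - exists 1%nat. intros n Hn. split; [apply Rabs_pos|].
      eapply Rle_trans; [apply HC|]. assert (0 < INR n) by (apply lt_0_INR; lia).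
      apply Rle_trans with (Rabs C / (2 * INR n + 1)).
      + apply Rmult_le_compat_r; [apply Rlt_le, Rinv_0_lt_compat; lra|apply Rle_abs].
      + apply Rmult_le_compat_l; [apply Rabs_pos|apply Rinv_le_contravar; lra].
    - apply is_lim_seq_const.
    - apply is_lim_seq_div_INR. }
  apply (is_lim_seq_ext (fun K => (fourier_rem K y - fourier_rem K (1 / 2)) + fourier_rem K (1 / 2))).
  { intros; ring. }
  replace e with (0 + e) by ring. apply is_lim_seq_plus'; trivial. }
assert (Hb : forall K x, (1 <= K)%nat -> 0 < x < 1 -> Rabs (fourier_rem K x - e) <= 1 / INR K).
{ clear K x. intros K x HK Hx0.
  assert (L : is_lim_seq (fun L => Rabs (fourier_rem K x - fourier_rem L x)) (Rabs (fourier_rem K x - e))).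
  { apply (is_lim_seq_abs _ (Finite (fourier_rem K x - e))).
    apply is_lim_seq_minus'; [apply is_lim_seq_const|apply Hx; trivial]. }
  apply (is_lim_seq_le_loc _ (fun _ => 1 / INR K) (Rabs (fourier_rem K x - e)) (1 / INR K)) in L.
  - exact L.
  - exists K. intros n Hn. unfold fourier_rem.
    replace (_ - _) with (sum1 (u x) n - sum1 (u x) K) by (unfold u; ring).
    apply sum1_tail_le; try lra; try lia. intros k Hk. apply fourier_coeff_bound; lia.
  - apply is_lim_seq_const. }
assert (He0 : e = 0).
{ assert (Habs : forall n, (1 <= n)%nat -> Rabs e <= 1 / INR n).
  { intros n Hn.
    assert (Hi : is_RInt (fun x => fourier_rem n x - e) 0 1 (- e)).
    { replace (- e) with (0 - (1 - 0) * e) by ring.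
      apply (is_RInt_minus (V := R_NormedModule)); [apply is_RInt_fourier_rem|apply (is_RInt_const (V := R_NormedModule))]. }
    rewrite <- Rabs_Ropp. replace (1 / INR n) with ((1 - 0) * (1 / INR n)) by ring.
    (* The pointwise bound holds on the open interval, while the integral estimate asks for it on
       the closed one; the integrand is therefore set to 0 at the endpoints. *)
    apply (is_RInt_ext _ (fun x => if Rlt_dec 0 x then if Rlt_dec x 1 then fourier_rem n x - e else 0 else 0)) in Hi.
    - apply (norm_RInt_le_const (V := R_NormedModule) _ 0 1 (- e) (1 / INR n) ltac:(lra)) with (2 := Hi).
      intros y Hy. assert (0 <= 1 / INR n) by (apply Rlt_le, Rdiv_lt_0_compat; [lra|apply lt_0_INR; lia]).
      destruct Rlt_dec; [destruct Rlt_dec|]; [apply Hb; trivial; lra| |]; change (Rabs 0 <= 1 / INR n); rewrite Rabs_R0; trivial.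
    - intros y. rewrite Rmin_left, Rmax_right by lra. intros Hy.
      destruct Rlt_dec; [destruct Rlt_dec|]; lra. }
  destruct (Req_dec e 0) as [H|H]; trivial. exfalso.
  apply Rabs_pos_lt in H.
  pose proof (is_lim_seq_div_INR 1) as Hl. apply is_lim_seq_spec in Hl.
  destruct (Hl (mkposreal _ H)) as [N HN]. specialize (HN (S N) ltac:(lia)).
  rewrite Rminus_0_r in HN. apply Rabs_lt_between in HN. simpl pos in HN.
  specialize (Habs (S N) ltac:(lia)). lra. }
intros HK Hx0. specialize (Hb K x HK Hx0). rewrite He0, Rminus_0_r in Hb.
eapply Rle_trans; [apply Hb|]. apply Rmult_le_compat_r; [|lra].
apply Rlt_le, Rinv_0_lt_compat, lt_0_INR; lia.
Qed.

(** * Asymptotic series of the integrated difference equation *)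

(** Origin of the constants: dividing B_2 (x) / 2 by m + x leaves the remainder B_2 (- m) / 2 = m (m
    + 1) / 2 + 1 / 12, the coefficient of the logarithm, and the quotient (x - (m + 1)) / 2, whose
    integral over [0, 1] is - (2 m + 1) / 4. *)
Definition barnes_step (m : R) : R :=
  (m * (m + 1) / 2 + 1 / 12) * (ln (m + 1) - ln m) - (2 * m + 1) / 4.

Lemma is_RInt_barnes_step m : 0 < m ->
  is_RInt (fun x => (x ^ 2 - x + 1 / 6) / (2 * (m + x))) 0 1 (barnes_step m).
Proof.
intros Hm.
set (F := fun x => x ^ 2 / 4 - (m + 1) * x / 2 + (m * (m + 1) / 2 + 1 / 12) * ln (m + x)).
replace (barnes_step m) with (F 1 - F 0).
2:{ unfold F, barnes_step. rewrite Rplus_0_r. field. }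
apply (is_RInt_derive (V := R_CompleteNormedModule) F).
- intros x. rewrite Rmin_left, Rmax_right by lra. intros Hx. unfold F.
  auto_derive; [lra|]. field. lra.
- intros x. rewrite Rmin_left, Rmax_right by lra. intros Hx.
  apply (ex_derive_continuous (K := R_AbsRing) (V := R_NormedModule)).
  auto_derive. lra.
Qed.

(** * Oscillatory integrals and the expansion of one step *)

Definition osc (k j : nat) (m : R) : R :=
  RInt (fun x => cos (freq k * x) / (m + x) ^ j) 0 1.

Lemma ex_RInt_osc k j m : 0 < m ->
  ex_RInt (fun x => cos (freq k * x) / (m + x) ^ j) 0 1.
Proof.
intros Hm. apply (ex_RInt_continuous (V := R_CompleteNormedModule)).
intros x. rewrite Rmin_left, Rmax_right by lra. intros Hx.
apply (ex_derive_continuous (K := R_AbsRing) (V := R_NormedModule)).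
auto_derive. apply pow_nonzero; lra.
Qed.

Lemma is_RInt_osc k j m : 0 < m ->
  is_RInt (fun x => cos (freq k * x) / (m + x) ^ j) 0 1 (osc k j m).
Proof.
intros Hm. apply (RInt_correct (V := R_CompleteNormedModule)), ex_RInt_osc, Hm.
Qed.

Lemma osc_bound k j m : 0 < m -> Rabs (osc k j m) <= / m ^ j.
Proof.
intros Hm. replace (/ m ^ j) with ((1 - 0) * / m ^ j) by ring.
apply (norm_RInt_le_const (V := R_NormedModule)) with (3 := is_RInt_osc k j m Hm); [lra|].
intros x Hx. change (Rabs (cos (freq k * x) / (m + x) ^ j) <= / m ^ j).
unfold Rdiv. rewrite Rabs_mult.
assert (0 < m ^ j) by (apply pow_lt; trivial).
assert (m ^ j <= (m + x) ^ j) by (apply pow_incr; lra).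
rewrite (Rabs_right (/ _)) by (apply Rle_ge, Rlt_le, Rinv_0_lt_compat; lra).
rewrite <- (Rmult_1_l (/ m ^ j)). apply Rmult_le_compat; try apply Rabs_pos.
- apply Rlt_le, Rinv_0_lt_compat; lra.
- apply Rabs_le, COS_bound.
- apply Rinv_le_contravar; lra.
Qed.

(** Two integrations by parts. The sine boundary term vanishes at both ends and the cosine equals 1
    there, because [freq k] is a multiple of 2 pi; the surviving boundary term is a difference of
    one function between m + 1 and m. *)
Lemma osc_by_parts k i m : (1 <= k)%nat -> 0 < m ->
  osc k (S i) m =
  - (INR (S i) / freq k ^ 2) * (/ (m + 1) ^ (S (S i)) - / m ^ (S (S i)))
  - INR (S i) * INR (S (S i)) / freq k ^ 2 * osc k (S (S (S i))) m.
Proof.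
intros Hk Hm. pose proof (freq_pos k Hk) as Hc. set (c := freq k) in *.
set (F := fun x => sin (c * x) / (c * (m + x) ^ (S i))
                   - INR (S i) * cos (c * x) / (c ^ 2 * (m + x) ^ (S (S i)))).
set (q := INR (S i) * INR (S (S i)) / c ^ 2).
assert (H1 : is_RInt (fun x => cos (c * x) / (m + x) ^ (S i)
    + q * (cos (c * x) / (m + x) ^ (S (S (S i))))) 0 1 (F 1 - F 0)).
{ apply (is_RInt_derive (V := R_CompleteNormedModule) F).
  - intros x. rewrite Rmin_left, Rmax_right by lra. intros Hx. unfold F, q.
    assert (Hp : (m + x) ^ i <> 0) by (apply pow_nonzero; lra).
    auto_derive.
    + assert (c <> 0) by lra. assert (m + x <> 0) by lra.
      repeat split; simpl;
        repeat (assumption || apply Rmult_integral_contrapositive_currified || lra).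
    + rewrite (S_INR (S i)).
      change (match i with O => 1 | S _ => INR i + 1 end) with (INR (S i)).
      rewrite <- !tech_pow_Rmult. field. repeat split; trivial; lra.
  - intros x. rewrite Rmin_left, Rmax_right by lra. intros Hx.
    apply (ex_derive_continuous (K := R_AbsRing) (V := R_NormedModule)).
    assert (Hp : (m + x) ^ i <> 0) by (apply pow_nonzero; lra).
    assert (m + x <> 0) by lra.
    auto_derive. repeat split; simpl;
      repeat (assumption || apply Rmult_integral_contrapositive_currified || lra). }
assert (H2 := is_RInt_plus (V := R_NormedModule) _ _ _ _ _ _ (is_RInt_osc k (S i) m Hm)
  (is_RInt_scal (V := R_NormedModule) _ _ _ q _ (is_RInt_osc k (S (S (S i))) m Hm))).
apply (is_RInt_unique (V := R_CompleteNormedModule)) in H1.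
apply (is_RInt_unique (V := R_CompleteNormedModule)) in H2.
assert (E : F 1 - F 0 = osc k (S i) m + q * osc k (S (S (S i))) m).
{ rewrite <- H1. exact H2. }
replace (osc k (S i) m) with (F 1 - F 0 - q * osc k (S (S (S i))) m) by lra.
unfold F, q. rewrite Rmult_1_r, Rmult_0_r, Rplus_0_r, sin_0, cos_0.
unfold c. rewrite sin_freq, cos_freq. fold c.
assert (m ^ i <> 0) by (apply pow_nonzero; lra).
assert ((m + 1) ^ i <> 0) by (apply pow_nonzero; lra).
rewrite <- !tech_pow_Rmult. field. repeat split; trivial; lra.
Qed.

(** The difference is the integral of [fourier_rem K x] / (2 (m + x)), which is at most (2 / K) / (2
    m). Only finitely many terms are integrated. *)
Lemma barnes_step_fourier K m : (1 <= K)%nat -> 0 < m ->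
  Rabs (barnes_step m - sum1 (fun k => 2 / freq k ^ 2 * osc k 1 m) K) <= / m / INR K.
Proof.
intros HK Hm.
assert (HI : is_RInt (fun x => fourier_rem K x / (2 * (m + x))) 0 1
  (barnes_step m - sum1 (fun k => 2 / freq k ^ 2 * osc k 1 m) K)).
{ clear HK. induction K as [|K IH].
  - simpl. rewrite Rminus_0_r.
    apply (is_RInt_ext (V := R_NormedModule)) with (2 := is_RInt_barnes_step m Hm).
    intros x _. unfold fourier_rem. simpl sum1. rewrite Rminus_0_r. reflexivity.
  - assert (H : is_RInt (fun x => fourier_rem K x / (2 * (m + x))
        - 2 / freq (S K) ^ 2 * (cos (freq (S K) * x) / (m + x) ^ 1)) 0 1
      (barnes_step m - sum1 (fun k => 2 / freq k ^ 2 * osc k 1 m) K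
        - 2 / freq (S K) ^ 2 * osc (S K) 1 m)).
    { exact (is_RInt_minus (V := R_NormedModule) _ _ _ _ _ _ IH
        (is_RInt_scal (V := R_NormedModule) _ _ _ (2 / freq (S K) ^ 2) _ (is_RInt_osc (S K) 1 m Hm))). }
    rewrite sum1_S.
    replace (barnes_step m - _) with (barnes_step m - sum1 (fun k => 2 / freq k ^ 2 * osc k 1 m) K
        - 2 / freq (S K) ^ 2 * osc (S K) 1 m) by ring.
    apply (is_RInt_ext (V := R_NormedModule)) with (2 := H).
    intros x. rewrite Rmin_left, Rmax_right by lra. intros Hx.
    match goal with |- ?a = ?b => change (@eq R a b) end.
    unfold fourier_rem. rewrite sum1_S. pose proof (freq_pos (S K) ltac:(lia)).
    field. lra. }
replace (/ m / INR K) with ((1 - 0) * (/ m / INR K)) by ring.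
(* As before, the integrand is set to 0 at the endpoints, where [fourier_rem_bound] says nothing. *)
apply (is_RInt_ext (V := R_NormedModule) _ (fun x => if Rlt_dec 0 x then if Rlt_dec x 1 then fourier_rem K x / (2 * (m + x)) else 0 else 0)) in HI.
- apply (norm_RInt_le_const (V := R_NormedModule)) with (3 := HI); [lra|].
  intros x Hx.
  assert (HKp : 0 < INR K) by (apply lt_0_INR; lia).
  assert (0 < / m) by (apply Rinv_0_lt_compat; trivial).
  assert (0 < / INR K) by (apply Rinv_0_lt_compat; trivial).
  assert (Hq : 0 <= / m / INR K) by (apply Rmult_le_pos; lra).
  match goal with |- norm ?a <= ?b => change (Rabs a <= b) end.
  destruct Rlt_dec; [destruct Rlt_dec|]; [|rewrite Rabs_R0; trivial..].
  unfold Rdiv at 1. rewrite Rabs_mult.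
  rewrite (Rabs_right (/ _)) by (apply Rle_ge, Rlt_le, Rinv_0_lt_compat; lra).
  pose proof (fourier_rem_bound K x HK ltac:(lra)).
  replace (/ m / INR K) with (2 / INR K * / (2 * m)) by (field; lra).
  apply Rmult_le_compat; trivial; try apply Rabs_pos.
  + apply Rlt_le, Rinv_0_lt_compat; lra.
  + apply Rinv_le_contravar; lra.
- intros x. rewrite Rmin_left, Rmax_right by lra. intros Hx.
  destruct Rlt_dec; [destruct Rlt_dec|]; trivial; lra.
Qed.

Definition freq_sum (i K : nat) : R := sum1 (fun k => / freq k ^ (2 * i + 2)) K.

(** The value is zeta (2 i + 2) / (2 pi)^(2 i + 2). *)
Definition freq_zeta (i : nat) : R := real (Lim_seq (freq_sum i)).

(** For i >= 1 this is B_(2i+2) / (2i (2i + 1) (2i + 2)), with B_(2i+2) a Bernoulli number. At i = 0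
    the truncated subtraction gives 0!; the sums [sum1] start at 1 and [log_coeff] puts 0 there. *)
Definition barnes_coeff (i : nat) : R :=
  (-1) ^ i * 2 * INR (fact (2 * i - 1)) * freq_zeta i.

Lemma freq_pow_bound i k : (1 <= k)%nat ->
  0 < / freq k ^ (2 * i + 2) <= 1 / INR k ^ 2 / 4.
Proof.
intros Hk. pose proof (freq_ge k Hk) as Hc.
assert (1 <= INR k) by (apply (le_INR 1); trivial).
split; [apply Rinv_0_lt_compat, pow_lt; lra|].
replace (1 / INR k ^ 2 / 4) with (/ (2 * INR k) ^ 2) by (field; lra).
apply Rinv_le_contravar; [apply pow_lt; lra|].
rewrite pow_add. rewrite <- (Rmult_1_l ((2 * INR k) ^ 2)).
apply Rmult_le_compat; try lra.
- apply pow_le; lra.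
- apply pow_R1_Rle; lra.
- apply pow_incr; lra.
Qed.

Lemma is_lim_freq_sum i : is_lim_seq (freq_sum i) (freq_zeta i).
Proof.
destruct (sum1_ex_lim (fun k => / freq k ^ (2 * i + 2)) 1) as [l Hl].
- intros k Hk. pose proof (freq_pow_bound i k Hk). rewrite Rabs_right by lra.
  assert (0 < 1 / INR k ^ 2); [|lra].
  apply Rdiv_lt_0_compat; [lra|]. apply pow_lt, lt_0_INR; lia.
- unfold freq_zeta. rewrite (is_lim_seq_unique (freq_sum i) _ Hl). exact Hl.
Qed.

Definition inv_pow_diff (i : nat) (m : R) : R := / (m + 1) ^ (2 * i) - / m ^ (2 * i).

(** From M to M + 1, [osc_by_parts] is applied to the last sum: the boundary term carries (2 M)! (2
    M + 1) = (2 (M + 1) - 1)!, and the new integral carries (2 M)! (2 M + 1) (2 M + 2) = (2 (M +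
    1))!. *)
Lemma osc_sum_expansion M K m : 0 < m ->
  sum1 (fun k => 2 / freq k ^ 2 * osc k 1 m) K =
  sum1 (fun i => (-1) ^ i * 2 * INR (fact (2 * i - 1)) * freq_sum i K * inv_pow_diff i m) M
  + (-1) ^ M * INR (fact (2 * M)) * sum1 (fun k => 2 / freq k ^ (2 * M + 2) * osc k (2 * M + 1) m) K.
Proof.
intros Hm. induction M as [|M IH].
- transitivity (0 + 1 * 1 * sum1 (fun k => 2 / freq k ^ 2 * osc k 1 m) K); [ring|reflexivity].
- rewrite IH, sum1_S.
  replace (2 * S M - 1)%nat with (S (2 * M)) by lia.
  replace (fact (2 * S M)) with (fact (S (S (2 * M)))) by (f_equal; lia).
  rewrite !fact_simpl, !mult_INR.
  rewrite (sum1_ext (fun k => 2 / freq k ^ (2 * M + 2) * osc k (2 * M + 1) m) (fun k =>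
    - (2 * INR (S (2 * M)) * inv_pow_diff (S M) m) * / freq k ^ (2 * S M + 2)
    + - (INR (S (2 * M)) * INR (S (S (2 * M)))) * (2 / freq k ^ (2 * S M + 2) * osc k (2 * S M + 1) m))).
  + rewrite sum1_plus, 2!sum1_scal. fold (freq_sum (S M) K).
    rewrite <- (tech_pow_Rmult (-1) M). ring.
  + intros k Hk. replace (2 * M + 1)%nat with (S (2 * M)) by lia.
    rewrite osc_by_parts by (trivial; lia).
    replace (2 * S M + 1)%nat with (S (S (S (2 * M)))) by lia.
    replace (2 * S M + 2)%nat with (2 + (2 * M + 2))%nat by lia.
    unfold inv_pow_diff. replace (2 * S M)%nat with (S (S (2 * M))) by lia.
    rewrite (pow_add _ 2 (2 * M + 2)).
    pose proof (freq_pos k ltac:(lia)).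
    assert (freq k ^ (2 * M + 2) <> 0) by (apply pow_nonzero; lra).
    set (A := / (m + 1) ^ _). set (B := / m ^ _).
    field. split; trivial; lra.
Qed.

Lemma sum1_inv_sq_le K : sum1 (fun k => 1 / INR k ^ 2) K <= 2.
Proof.
destruct K as [|K]; [simpl; lra|].
assert (H := sum1_tail (fun k => 1 / INR k ^ 2) 1 1 (S K)).
assert (0 < / INR (S K)) by (apply Rinv_0_lt_compat, lt_0_INR; lia).
assert (H1 : sum1 (fun k => 1 / INR k ^ 2) 1 = 1) by (simpl; field).
rewrite H1 in H. change (INR 1) with 1 in H.
assert (H2 : Rabs (sum1 (fun k => 1 / INR k ^ 2) (S K) - 1) <= 1 * (/ 1 - / INR (S K))).
{ apply H; [|lia]. intros k Hk. rewrite Rabs_right; [lra|].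
  apply Rle_ge, Rlt_le, Rdiv_lt_0_compat; [lra|]. apply pow_lt, lt_0_INR; lia. }
apply Rabs_le_between in H2. lra.
Qed.

Lemma sum1_lim (u : nat -> nat -> R) (l : nat -> R) M :
  (forall i, is_lim_seq (u i) (l i)) -> is_lim_seq (fun K => sum1 (fun i => u i K) M) (sum1 l M).
Proof.
intros H. induction M as [|M IH]; simpl.
- apply is_lim_seq_const.
- apply is_lim_seq_plus'; trivial.
Qed.

(** The remaining sum of integrals is bounded independently of K, the factor 2 being the bound of
    [sum1_inv_sq_le], while the Fourier error is 1 / (m K); K then tends to infinity. *)
Lemma barnes_step_expansion M m : 0 < m ->
  Rabs (barnes_step m - sum1 (fun i => barnes_coeff i * inv_pow_diff i m) M)
  <= 2 * INR (fact (2 * M)) / m ^ (2 * M + 1).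
Proof.
intros Hm.
set (f := fun K => Rabs (barnes_step m - sum1 (fun i => (-1) ^ i * 2 * INR (fact (2 * i - 1)) * freq_sum i K * inv_pow_diff i m) M)).
assert (Hf : is_lim_seq f (Rabs (barnes_step m - sum1 (fun i => barnes_coeff i * inv_pow_diff i m) M))).
{ apply (is_lim_seq_abs _ (Finite _)). apply is_lim_seq_minus'; [apply is_lim_seq_const|].
  apply (sum1_lim (fun i K => (-1) ^ i * 2 * INR (fact (2 * i - 1)) * freq_sum i K * inv_pow_diff i m)).
  intros i. apply is_lim_seq_mult'; [|apply is_lim_seq_const].
  apply is_lim_seq_mult'; [apply is_lim_seq_const|apply is_lim_freq_sum]. }
set (B := 2 * INR (fact (2 * M)) / m ^ (2 * M + 1)).
assert (Hg : is_lim_seq (fun K => / m / INR K + B) B).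
{ pose proof (is_lim_seq_plus' _ _ _ _ (is_lim_seq_div_INR (/ m)) (is_lim_seq_const B)) as H.
  rewrite Rplus_0_l in H. exact H. }
refine (is_lim_seq_le_loc f _ _ _ _ Hf Hg).
exists 1%nat. intros K HK. unfold f.
pose proof (barnes_step_fourier K m HK Hm) as H1.
rewrite (osc_sum_expansion M K m Hm) in H1.
set (T := (-1) ^ M * _ * _) in H1.
assert (HT : Rabs T <= B).
{ unfold T, B. rewrite !Rabs_mult, pow_1_abs, Rmult_1_l.
  rewrite (Rabs_right (INR _)) by (apply Rle_ge, pos_INR).
  replace (2 * INR (fact (2 * M)) / m ^ (2 * M + 1)) with (INR (fact (2 * M)) * (/ m ^ (2 * M + 1) * 2)).
  2:{ unfold Rdiv; ring. }
  apply Rmult_le_compat_l; [apply pos_INR|].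
  assert (0 < / m ^ (2 * M + 1)) by (apply Rinv_0_lt_compat, pow_lt; trivial).
  apply Rle_trans with (sum1 (fun k => / m ^ (2 * M + 1) * (1 / INR k ^ 2)) K).
  - apply sum1_Rabs_le. intros k Hk. rewrite Rabs_mult, Rmult_comm.
    pose proof (freq_pow_bound M k ltac:(lia)).
    assert (0 < 1 / INR k ^ 2) by (apply Rdiv_lt_0_compat; [lra|apply pow_lt, lt_0_INR; lia]).
    apply Rmult_le_compat; try apply Rabs_pos; [apply osc_bound; trivial|].
    unfold Rdiv. rewrite Rabs_right; lra.
  - rewrite sum1_scal. apply Rmult_le_compat_l; [lra|apply sum1_inv_sq_le]. }
match goal with |- Rabs (?a - ?b) <= _ => replace (a - b) with ((a - (b + T)) + T) by ring end.
eapply Rle_trans; [apply Rabs_triang|]. lra.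
Qed.

(** As [v] tends to 0, [v m] is minus the sum of its increments from m on. For n >= m, 1 / n^(p+2)
    <= m^(-p) / n^2 and 1 / n^2 <= 2 (1 / n - 1 / (n + 1)), so one power of m is lost and the
    constant doubles. *)
Lemma telescoping_decay (v : nat -> R) (C : R) (p : nat) : is_lim_seq v 0 ->
  (forall m, (1 <= m)%nat -> Rabs (v (S m) - v m) <= C / INR m ^ (p + 2)) ->
  forall m, (1 <= m)%nat -> Rabs (v m) <= 2 * C / INR m ^ (p + 1).
Proof.
intros Hv Hd m Hm.
assert (Hmp : 0 < INR m) by (apply lt_0_INR; lia).
assert (HC : 0 <= C).
{ specialize (Hd 1%nat (le_n _)). change (INR 1) with 1 in Hd. rewrite pow1 in Hd.
  pose proof (Rabs_pos (v 2%nat - v 1%nat)). lra. }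
assert (HCm : 0 <= C / INR m ^ p).
{ apply Rmult_le_pos; trivial. apply Rlt_le, Rinv_0_lt_compat, pow_lt; trivial. }
assert (Hb : forall n, (m <= n)%nat -> Rabs (v n - v m) <= 2 * (C / INR m ^ p) * (/ INR m - / INR n)).
{ intros n Hn. induction Hn as [|n Hn IH].
  - rewrite Rminus_diag, Rabs_R0. lra.
  - replace (v (S n) - v m) with ((v (S n) - v n) + (v n - v m)) by ring.
    eapply Rle_trans; [apply Rabs_triang|].
    assert (Hmn : INR m <= INR n) by (apply le_INR; trivial).
    assert (Hn1 : 1 <= INR n) by (apply (le_INR 1); lia).
    assert (Rabs (v (S n) - v n) <= 2 * (C / INR m ^ p) * (/ INR n - / INR (S n))).
    { eapply Rle_trans; [apply Hd; lia|]. rewrite pow_add.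
      replace (C / (INR n ^ p * INR n ^ 2)) with ((C / INR n ^ p) * (/ INR n ^ 2)).
      2:{ field. split; [lra|]. apply pow_nonzero; lra. }
      replace (2 * (C / INR m ^ p) * (/ INR n - / INR (S n))) with ((C / INR m ^ p) * (2 * (/ INR n - / INR (S n)))) by ring.
      apply Rmult_le_compat.
      - apply Rmult_le_pos; trivial. apply Rlt_le, Rinv_0_lt_compat, pow_lt; lra.
      - apply Rlt_le, Rinv_0_lt_compat, pow_lt; lra.
      - apply Rmult_le_compat_l; trivial. apply Rinv_le_contravar; [apply pow_lt; trivial|].
        apply pow_incr; lra.
      - rewrite S_INR. replace (2 * (/ INR n - / (INR n + 1))) with (/ ((INR n * (INR n + 1)) / 2)) by (field; lra).
        apply Rinv_le_contravar; nra. }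
    lra. }
assert (L : is_lim_seq (fun n => Rabs (v n - v m)) (Rabs (0 - v m))).
{ apply (is_lim_seq_abs _ (Finite _)). apply is_lim_seq_minus'; trivial. apply is_lim_seq_const. }
replace (Rabs (v m)) with (Rabs (0 - v m)) by (rewrite <- (Rabs_Ropp (v m)); f_equal; ring).
refine (is_lim_seq_le_loc _ (fun _ => 2 * C / INR m ^ (p + 1)) _ _ _ L (is_lim_seq_const _)).
exists m. intros n Hn. eapply Rle_trans; [apply Hb; trivial|].
rewrite pow_add, pow_1.
replace (2 * C / (INR m ^ p * INR m)) with (2 * (C / INR m ^ p) * / INR m).
2:{ field. split; [lra|apply pow_nonzero; lra]. }
apply Rmult_le_compat_l; [lra|].
assert (0 < / INR n) by (apply Rinv_0_lt_compat, lt_0_INR; lia). lra.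
Qed.

Lemma is_lim_seq_inv_pow (p : nat) : (1 <= p)%nat -> is_lim_seq (fun m => / INR m ^ p) 0.
Proof.
intros Hp.
apply (is_lim_seq_le_le_loc (fun _ => 0) _ (fun m => 1 / INR m)).
- exists 1%nat. intros m Hm. assert (1 <= INR m) by (apply (le_INR 1); trivial).
  split; [apply Rlt_le, Rinv_0_lt_compat, pow_lt; lra|].
  unfold Rdiv. rewrite Rmult_1_l. apply Rinv_le_contravar; [lra|].
  rewrite <- (pow_1 (INR m)) at 1. apply Rle_pow; trivial.
- apply is_lim_seq_const.
- apply is_lim_seq_div_INR.
Qed.

(** Apply [telescoping_decay] to H minus the truncated series: the increments of the series are
    exactly the [inv_pow_diff] terms in the expansion of the step. *)
Lemma barnes_expansion_of_step (H : nat -> R) : is_lim_seq H 0 ->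
  (forall m, (1 <= m)%nat -> H (S m) - H m = barnes_step (INR m)) ->
  forall M, (1 <= M)%nat -> exists C, forall m, (1 <= m)%nat ->
  Rabs (H m - sum1 (fun i => barnes_coeff i / INR m ^ (2 * i)) M) <= C / INR m ^ (2 * M).
Proof.
intros H0 Hd M HM. exists (2 * (2 * INR (fact (2 * M)))).
(* The exponent of [telescoping_decay] is p = 2 M - 1: increments of order 2 M + 1 give decay of
   order 2 M. *)
intros m Hm. replace (INR m ^ (2 * M)) with (INR m ^ ((2 * M - 1) + 1)) by (f_equal; lia).
revert m Hm.
apply (telescoping_decay (fun m => H m - sum1 (fun i => barnes_coeff i / INR m ^ (2 * i)) M)).
- replace 0 with (0 - sum1 (fun i => 0 * 0) M) by (rewrite sum1_scal; ring).
  apply is_lim_seq_minus'; trivial. clear HM.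
  induction M as [|M IH]; [apply is_lim_seq_const|]. rewrite sum1_S.
  apply (is_lim_seq_ext (fun m => sum1 (fun i => barnes_coeff i / INR m ^ (2 * i)) M + barnes_coeff (S M) * / INR m ^ (2 * S M))).
  { intros m. reflexivity. }
  apply is_lim_seq_plus'; trivial. replace (0 * 0) with (barnes_coeff (S M) * 0) by ring.
  apply is_lim_seq_mult'; [apply is_lim_seq_const|]. apply is_lim_seq_inv_pow. lia.
- intros m Hm. assert (Hmp : 0 < INR m) by (apply lt_0_INR; lia).
  replace (2 * M - 1 + 2)%nat with (2 * M + 1)%nat by lia.
  pose proof (barnes_step_expansion M (INR m) Hmp) as E. rewrite <- (Hd m Hm) in E.
  rewrite (sum1_ext (fun i => barnes_coeff i * inv_pow_diff i (INR m))
    (fun i => barnes_coeff i / INR (S m) ^ (2 * i) + (-1) * (barnes_coeff i / INR m ^ (2 * i)))) in E.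
  2:{ intros i _. unfold inv_pow_diff. rewrite S_INR. unfold Rdiv. ring. }
  rewrite sum1_plus, sum1_scal in E.
  match type of E with Rabs ?a <= _ => match goal with |- Rabs ?b <= _ =>
    replace b with a by ring end end.
  exact E.
Qed.

(** * Exponentials of asymptotic series *)

Fixpoint psum (c : nat -> R) (n : nat) (x : R) : R :=
  match n with O => 0 | S m => psum c m x + c m * x ^ m end.

(** Cauchy product; recursion shifts the first factor, in step with [psum_shift]. *)
Fixpoint conv (a b : nat -> R) (n : nat) : R :=
  match n with
  | O => a 0%nat * b 0%nat
  | S m => a 0%nat * b (S m) + conv (fun i => a (S i)) b m
  end.

(** Coefficients of the formal derivative. *)
Definition dcoeff (c : nat -> R) (n : nat) : R := INR (S n) * c (S n).

Lemma psum_ext (c d : nat -> R) n x :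
  (forall k, (k < n)%nat -> c k = d k) -> psum c n x = psum d n x.
Proof.
induction n as [|n IH]; simpl; intros H; trivial.
rewrite IH, H; trivial; try lia. intros; apply H; lia.
Qed.

Lemma psum_lin (c d : nat -> R) (s t : R) n x :
  psum (fun k => s * c k + t * d k) n x = s * psum c n x + t * psum d n x.
Proof. induction n as [|n IH]; simpl; [ring|rewrite IH; ring]. Qed.

Lemma psum_shift (c : nat -> R) n x :
  psum c (S n) x = c 0%nat + x * psum (fun k => c (S k)) n x.
Proof.
induction n as [|n IH]; [simpl; ring|].
change (psum c (S (S n)) x) with (psum c (S n) x + c (S n) * x ^ (S n)).
rewrite IH. simpl. ring.
Qed.

Lemma psum_0 (c : nat -> R) n : psum c (S n) 0 = c 0%nat.
Proof. rewrite psum_shift; ring. Qed.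

Lemma psum_bound (c : nat -> R) n : exists K, 0 <= K /\
  forall x, 0 <= x <= 1 -> Rabs (psum c n x) <= K.
Proof.
induction n as [|n [K [HK IH]]]; simpl.
- exists 0. split; [lra|]. intros. rewrite Rabs_R0. lra.
- exists (K + Rabs (c n)). pose proof (Rabs_pos (c n)). split; [lra|]. intros x Hx.
  eapply Rle_trans; [apply Rabs_triang|]. apply Rplus_le_compat; [apply IH; trivial|].
  rewrite Rabs_mult. rewrite <- (Rmult_1_r (Rabs (c n))) at 2.
  apply Rmult_le_compat_l; trivial.
  rewrite Rabs_right by (apply Rle_ge, pow_le; lra).
  rewrite <- (pow1 n). apply pow_incr; lra.
Qed.

Lemma is_derive_psum (c : nat -> R) n x :
  is_derive (psum c (S n)) x (psum (dcoeff c) n x).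
Proof.
induction n as [|n IH].
- simpl. auto_derive; trivial; ring.
- apply (is_derive_Rext (fun x => psum c (S n) x + c (S n) * x ^ (S n))); [reflexivity|].
  apply is_derive_eq with (psum (dcoeff c) n x + c (S n) * (INR (S n) * x ^ n)).
  + apply is_derive_Rplus; trivial. auto_derive; trivial.
    change (match n with O => 1 | S _ => INR n + 1 end) with (INR (S n)). ring.
  + change (psum (dcoeff c) (S n) x) with (psum (dcoeff c) n x + dcoeff c n * x ^ n).
    unfold dcoeff. ring.
Qed.

Lemma conv_ext (a b b' : nat -> R) n :
  (forall k, (k <= n)%nat -> b k = b' k) -> conv a b n = conv a b' n.
Proof.
revert a. induction n as [|n IH]; simpl; intros a H; rewrite H by lia; trivial.
rewrite IH; trivial. intros; apply H; lia.
Qed.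

Lemma psum_conv (a b : nat -> R) n : exists K, 0 <= K /\
  forall x, 0 <= x <= 1 ->
  Rabs (psum a n x * psum b n x - psum (conv a b) n x) <= K * x ^ n.
Proof.
revert a. induction n as [|n IH]; intros a.
- exists 0. split; [lra|]. intros x _. simpl. rewrite Rmult_0_l, Rminus_0_r, Rabs_R0. lra.
- destruct (IH (fun i => a (S i))) as [K [HK H]].
  destruct (psum_bound (fun i => a (S i)) n) as [A [HA HAb]].
  exists (K + A * Rabs (b n)). pose proof (Rabs_pos (b n)).
  split; [apply Rplus_le_le_0_compat; trivial; apply Rmult_le_pos; lra|]. intros x Hx.
  specialize (H x Hx). specialize (HAb x Hx).
  set (As := psum (fun i => a (S i)) n x) in *.
  replace (psum a (S n) x * psum b (S n) x - psum (conv a b) (S n) x) with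
    (x * (As * psum b n x - psum (conv (fun i => a (S i)) b) n x) + As * b n * x ^ (S n)).
  + assert (Hxn : 0 <= x ^ n) by (apply pow_le; lra).
    eapply Rle_trans; [apply Rabs_triang|].
    rewrite Rmult_plus_distr_r. apply Rplus_le_compat.
    * rewrite Rabs_mult, (Rabs_right x) by lra. simpl.
      replace (K * (x * x ^ n)) with (x * (K * x ^ n)) by ring.
      apply Rmult_le_compat_l; lra.
    * rewrite !Rabs_mult, (Rabs_right (x ^ S n)) by (apply Rle_ge, pow_le; lra).
      apply Rmult_le_compat_r; [apply pow_le; lra|].
      apply Rmult_le_compat_r; trivial.
  + rewrite (psum_shift a), (psum_shift (conv a b)). fold As.
    rewrite (psum_ext (fun k => conv a b (S k))
      (fun k => a 0%nat * b (S k) + 1 * conv (fun i => a (S i)) b k)) by (intros; simpl; ring).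
    rewrite (psum_lin (fun k => b (S k))).
    change (conv a b 0) with (a 0%nat * b 0%nat).
    replace (psum (fun k => b (S k)) n x * x) with (psum b (S n) x - b 0%nat) by (rewrite psum_shift; ring).
    assert (E := psum_shift b n x).
    change (psum b (S n) x) with (psum b n x + b n * x ^ n) in *.
    rewrite <- (tech_pow_Rmult x n).
    replace (psum b n x) with (b 0%nat + x * psum (fun k => b (S k)) n x - b n * x ^ n) by lra.
    ring.
Qed.

Lemma bounded_on_unit (f : R -> R) : (forall x, 0 <= x <= 1 -> continuity_pt f x) ->
  exists K, 0 <= K /\ forall x, 0 <= x <= 1 -> Rabs (f x) <= K.
Proof.
intros Hf.
destruct (continuity_ab_maj f 0 1 ltac:(lra) Hf) as [M [HM _]].
destruct (continuity_ab_min f 0 1 ltac:(lra) Hf) as [m [Hm _]].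
exists (Rabs (f M) + Rabs (f m)).
pose proof (Rabs_pos (f M)). pose proof (Rabs_pos (f m)).
split; [lra|]. intros x Hx. specialize (HM x Hx). specialize (Hm x Hx).
pose proof (Rle_abs (f M)). pose proof (Rle_abs (- f m)). rewrite Rabs_Ropp in *.
apply Rabs_le; lra.
Qed.

Lemma flat_at_zero (f df : R -> R) (K B : R) (n : nat) : 0 <= K ->
  (forall x, 0 <= x <= B -> is_derive f x (df x)) ->
  (forall x, 0 <= x <= B -> Rabs (df x) <= K * x ^ n) ->
  forall x, 0 <= x <= B -> Rabs (f x - f 0) <= K * x ^ (S n).
Proof.
intros HK Hd Hb x Hx.
destruct (MVT_gen f 0 x df) as [c [Hc E]].
- intros y. rewrite Rmin_left, Rmax_right by lra. intros Hy. apply Hd; lra.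
- intros y. rewrite Rmin_left, Rmax_right by lra. intros Hy.
  apply derivable_continuous_pt. exists (df y). apply is_derive_Reals, Hd; lra.
- rewrite Rmin_left, Rmax_right in Hc by lra.
  rewrite E, Rminus_0_r, Rabs_mult, (Rabs_right x) by lra.
  replace (K * x ^ S n) with ((K * x ^ n) * x) by (simpl; ring).
  apply Rmult_le_compat_r; [lra|]. eapply Rle_trans; [apply Hb; lra|].
  apply Rmult_le_compat_l; trivial. apply pow_incr; lra.
Qed.

(** Real and imaginary parts of the coefficient of x^n in Q' = q P' Q, the differential equation of
    Q = exp (q P), where P has coefficients [a], Q has coefficients [b1] + i [b2], and q = u + i
    v. *)
Definition exp_recurrence (u v : R) (a b1 b2 : nat -> R) (n : nat) : Prop :=
  INR (S n) * b1 (S n) = u * conv (dcoeff a) b1 n - v * conv (dcoeff a) b2 n /\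
  INR (S n) * b2 (S n) = u * conv (dcoeff a) b2 n + v * conv (dcoeff a) b1 n.

(* [s], [t] stand for [u], [v] in the two components of the defect Q' - q P' Q. *)
Lemma ode_defect (s t : R) (a b c : nat -> R) (n : nat) :
  (forall k, (k < n)%nat ->
     INR (S k) * b (S k) = s * conv (dcoeff a) b k + t * conv (dcoeff a) c k) ->
  exists K, 0 <= K /\ forall x, 0 <= x <= 1 ->
  Rabs (psum (dcoeff b) n x - psum (dcoeff a) n x * (s * psum b (S n) x + t * psum c (S n) x))
  <= K * x ^ n.
Proof.
intros Hrec.
destruct (psum_conv (dcoeff a) b n) as [K1 [HK1 H1]].
destruct (psum_conv (dcoeff a) c n) as [K2 [HK2 H2]].
destruct (psum_bound (dcoeff a) n) as [A [HA HAb]].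
exists (Rabs s * K1 + Rabs t * K2 + A * Rabs (s * b n + t * c n)).
pose proof (Rabs_pos s). pose proof (Rabs_pos t). pose proof (Rabs_pos (s * b n + t * c n)).
split.
{ repeat apply Rplus_le_le_0_compat; apply Rmult_le_pos; lra. }
intros x Hx. specialize (H1 x Hx). specialize (H2 x Hx). specialize (HAb x Hx).
assert (E : psum (dcoeff b) n x =
  s * psum (conv (dcoeff a) b) n x + t * psum (conv (dcoeff a) c) n x).
{ rewrite <- psum_lin. apply psum_ext. intros k Hk. apply Hrec; trivial. }
rewrite E. simpl psum.
set (P := psum (dcoeff a) n x) in *.
match goal with |- Rabs ?l <= _ => replace l with
  (- (s * (P * psum b n x - psum (conv (dcoeff a) b) n x)
   + t * (P * psum c n x - psum (conv (dcoeff a) c) n x)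
   + P * (s * b n + t * c n) * x ^ n)) by ring end.
assert (0 <= x ^ n) by (apply pow_le; lra).
rewrite Rabs_Ropp. eapply Rle_trans; [apply Rabs_triang|]. rewrite Rmult_plus_distr_r.
apply Rplus_le_compat.
- eapply Rle_trans; [apply Rabs_triang|]. rewrite Rmult_plus_distr_r.
  apply Rplus_le_compat; rewrite Rabs_mult, Rmult_assoc; apply Rmult_le_compat_l; trivial.
- rewrite !Rabs_mult, (Rabs_right (x ^ n)) by lra.
  apply Rmult_le_compat_r; trivial. apply Rmult_le_compat_r; trivial.
Qed.

(* With P, Q the truncations of the series of [a] and of [b1 + i b2], and
   q = u + i v, the derivative of Q exp (- q P) is (Q' - q P' Q) exp (- q P). *)
Lemma exp_psum (u v : R) (a b1 b2 : nat -> R) (n : nat) :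
  a 0%nat = 0 -> b1 0%nat = 1 -> b2 0%nat = 0 ->
  (forall k, (k < n)%nat -> exp_recurrence u v a b1 b2 k) ->
  exists K, 0 <= K /\ forall x, 0 <= x <= 1 ->
  Rabs (exp (u * psum a (S n) x) * cos (v * psum a (S n) x) - psum b1 (S n) x) <= K * x ^ S n /\
  Rabs (exp (u * psum a (S n) x) * sin (v * psum a (S n) x) - psum b2 (S n) x) <= K * x ^ S n.
Proof.
intros Ha Hb1 Hb2 Hrec.
set (P := psum a (S n)). set (Q1 := psum b1 (S n)). set (Q2 := psum b2 (S n)).
destruct (ode_defect u (- v) a b1 b2 n) as [K1 [HK1 D1]].
{ intros k Hk. destruct (Hrec k Hk) as [-> _]. ring. }
destruct (ode_defect u v a b2 b1 n) as [K2 [HK2 D2]].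
{ intros k Hk. apply (Hrec k Hk). }
assert (Hcont : forall s x, continuity_pt (fun y => exp (s * P y)) x).
{ intros s x. apply derivable_continuous_pt. eexists. apply is_derive_Reals.
  apply (is_derive_comp exp (fun y => s * P y)); [apply is_derive_exp|].
  apply is_derive_scal, is_derive_psum. }
destruct (bounded_on_unit (fun x => exp (- u * P x))) as [E [HE HEb]]; [intros; apply Hcont|].
destruct (bounded_on_unit (fun x => exp (u * P x))) as [E' [HE' HEb']]; [intros; apply Hcont|].
set (R1 := fun x => psum (dcoeff b1) n x - psum (dcoeff a) n x * (u * Q1 x + - v * Q2 x)).
set (R2 := fun x => psum (dcoeff b2) n x - psum (dcoeff a) n x * (u * Q2 x + v * Q1 x)).
(* [F1] and [F2] are the real and imaginary parts of Q exp (- q P); [R1] and [R2] are those of the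
   defect Q' - q P' Q, which is of order x^n. *)
set (F1 := fun x => exp (- u * P x) * (Q1 x * cos (v * P x) + Q2 x * sin (v * P x))).
set (F2 := fun x => exp (- u * P x) * (Q2 x * cos (v * P x) - Q1 x * sin (v * P x))).
assert (HP : forall x, is_derive P x (psum (dcoeff a) n x)) by (intros; apply is_derive_psum).
assert (HQ1 : forall x, is_derive Q1 x (psum (dcoeff b1) n x)) by (intros; apply is_derive_psum).
assert (HQ2 : forall x, is_derive Q2 x (psum (dcoeff b2) n x)) by (intros; apply is_derive_psum).
assert (HF1 : forall x, is_derive F1 x (exp (- u * P x) * (cos (v * P x) * R1 x + sin (v * P x) * R2 x))).
{ intros x. unfold F1. auto_derive.
  - repeat split; eexists; eauto.
  - change (Derive (fun x0 => P x0) x) with (Derive P x).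
    change (Derive (fun x0 => Q1 x0) x) with (Derive Q1 x).
    change (Derive (fun x0 => Q2 x0) x) with (Derive Q2 x).
    rewrite (is_derive_unique _ _ _ (HP x)), (is_derive_unique _ _ _ (HQ1 x)), (is_derive_unique _ _ _ (HQ2 x)).
    unfold R1, R2. ring. }
assert (HF2 : forall x, is_derive F2 x (exp (- u * P x) * (cos (v * P x) * R2 x - sin (v * P x) * R1 x))).
{ intros x. unfold F2. auto_derive.
  - repeat split; eexists; eauto.
  - change (Derive (fun x0 => P x0) x) with (Derive P x).
    change (Derive (fun x0 => Q1 x0) x) with (Derive Q1 x).
    change (Derive (fun x0 => Q2 x0) x) with (Derive Q2 x).
    rewrite (is_derive_unique _ _ _ (HP x)), (is_derive_unique _ _ _ (HQ1 x)), (is_derive_unique _ _ _ (HQ2 x)).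
    unfold R1, R2. ring. }
assert (HB : forall e c s r1 r2 xn, Rabs e <= E -> Rabs c <= 1 -> Rabs s <= 1 ->
  Rabs r1 <= K1 * xn -> Rabs r2 <= K2 * xn ->
  Rabs (e * (c * r1 + s * r2)) <= E * (K1 + K2) * xn /\
  Rabs (e * (c * r2 - s * r1)) <= E * (K1 + K2) * xn).
{ intros e c s r1 r2 xn He Hc Hs Hr1 Hr2.
  assert (HM : forall y z r, Rabs y <= 1 -> Rabs r <= z -> Rabs (y * r) <= z).
  { intros y z r Hy Hr. rewrite Rabs_mult, <- (Rmult_1_l z).
    apply Rmult_le_compat; trivial; apply Rabs_pos. }
  rewrite !(Rabs_mult e), !Rmult_assoc.
  pose proof (HM _ _ _ Hc Hr1). pose proof (HM _ _ _ Hs Hr2).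
  pose proof (HM _ _ _ Hc Hr2). pose proof (HM _ _ _ Hs Hr1).
  split; apply Rmult_le_compat; trivial; try apply Rabs_pos.
  - eapply Rle_trans; [apply Rabs_triang|]. lra.
  - eapply Rle_trans; [apply Rabs_triang|]. rewrite Rabs_Ropp. lra. }
assert (HEK : 0 <= E * (K1 + K2)) by (apply Rmult_le_pos; lra).
assert (B1 : forall x, 0 <= x <= 1 -> Rabs (F1 x - 1) <= E * (K1 + K2) * x ^ S n).
{ assert (H0 : F1 0 = 1).
  { unfold F1, P, Q1, Q2. rewrite !psum_0, Ha, Hb1, Hb2, !Rmult_0_r, exp_0, cos_0. ring. }
  intros x Hx. replace (F1 x - 1) with (F1 x - F1 0) by (rewrite H0; ring).
  revert x Hx. apply flat_at_zero with (1 := HEK) (2 := fun x _ => HF1 x).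
  intros x Hx. apply HB; [apply HEb; trivial|apply Rabs_le, COS_bound|apply Rabs_le, SIN_bound
    |apply D1; trivial|apply D2; trivial]. }
assert (B2 : forall x, 0 <= x <= 1 -> Rabs (F2 x - 0) <= E * (K1 + K2) * x ^ S n).
{ assert (H0 : F2 0 = 0).
  { unfold F2, P, Q1, Q2. rewrite !psum_0, Ha, Hb1, Hb2, !Rmult_0_r, exp_0, cos_0, sin_0. ring. }
  intros x Hx. replace (F2 x - 0) with (F2 x - F2 0) by (rewrite H0; ring).
  revert x Hx. apply flat_at_zero with (1 := HEK) (2 := fun x _ => HF2 x).
  intros x Hx. apply HB; [apply HEb; trivial|apply Rabs_le, COS_bound|apply Rabs_le, SIN_bound
    |apply D1; trivial|apply D2; trivial]. }
exists (E' * (2 * (E * (K1 + K2)))). split; [apply Rmult_le_pos; lra|].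
intros x Hx. specialize (B1 x Hx). specialize (B2 x Hx). rewrite Rminus_0_r in B2.
specialize (HEb' x Hx). simpl in HEb'.
set (Z := E * (K1 + K2) * x ^ S n) in *.
pose proof (COS_bound (v * P x)) as Hc. pose proof (SIN_bound (v * P x)) as Hs.
assert (HI : exp (u * P x) * exp (- u * P x) = 1).
{ rewrite <- exp_plus. replace (_ + _) with 0 by ring. apply exp_0. }
assert (Hcs : sin (v * P x) ^ 2 + cos (v * P x) ^ 2 = 1).
{ pose proof (sin2_cos2 (v * P x)) as H. unfold Rsqr in H. lra. }
set (e := exp (u * P x)) in *. set (e' := exp (- u * P x)) in *.
set (c := cos (v * P x)) in *. set (s := sin (v * P x)) in *.
replace (E' * (2 * (E * (K1 + K2))) * x ^ S n) with (E' * (2 * Z)) by (unfold Z; ring).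
assert (Habs : forall y z, -1 <= y <= 1 -> Rabs (y * z) <= Rabs z).
{ intros y z Hy. rewrite Rabs_mult. rewrite <- (Rmult_1_l (Rabs z)) at 2.
  apply Rmult_le_compat_r; [apply Rabs_pos|apply Rabs_le; lra]. }
split.
(* Both cases multiply back: exp (q P) - Q = exp (q P) (1 - (F1 + i F2)), taken in real and
   imaginary part. *)
- replace (e * c - Q1 x) with (e * (s * F2 x - c * (F1 x - 1))).
  + rewrite Rabs_mult. apply Rmult_le_compat; trivial; try apply Rabs_pos.
    eapply Rle_trans; [apply Rabs_triang|]. rewrite Rabs_Ropp.
    pose proof (Habs s (F2 x) Hs). pose proof (Habs c (F1 x - 1) Hc). lra.
  + unfold F1, F2. fold e' c s.
    transitivity (e * c - (e * e') * (Q1 x * (s ^ 2 + c ^ 2))); [ring|].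
    rewrite HI, Hcs. ring.
- replace (e * s - Q2 x) with (- (e * (c * F2 x + s * (F1 x - 1)))).
  + rewrite Rabs_Ropp, Rabs_mult. apply Rmult_le_compat; trivial; try apply Rabs_pos.
    eapply Rle_trans; [apply Rabs_triang|].
    pose proof (Habs c (F2 x) Hc). pose proof (Habs s (F1 x - 1) Hs). lra.
  + unfold F1, F2. fold e' c s.
    transitivity (e * s - (e * e') * (Q2 x * (s ^ 2 + c ^ 2))); [ring|].
    rewrite HI, Hcs. ring.
Qed.

Lemma exp_cos_lipschitz (u v B : R) : exists K, 0 <= K /\
  forall s t, Rabs s <= B -> Rabs t <= B ->
  Rabs (exp (u * t) * cos (v * t) - exp (u * s) * cos (v * s)) <= K * Rabs (t - s) /\
  Rabs (exp (u * t) * sin (v * t) - exp (u * s) * sin (v * s)) <= K * Rabs (t - s).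
Proof.
(* Of the intermediate point y only |y - s| <= |t - s| <= 2 B is known, whence |y| <= 3 B. *)
exists (exp (Rabs u * (3 * B)) * (Rabs u + Rabs v)).
pose proof (Rabs_pos u). pose proof (Rabs_pos v). pose proof (exp_pos (Rabs u * (3 * B))).
split; [apply Rmult_le_pos; lra|]. intros s t Hs Ht.
assert (HD : forall y c1 c2, Rabs (y - s) <= Rabs (t - s) -> -1 <= c1 <= 1 -> -1 <= c2 <= 1 ->
  Rabs (exp (u * y) * (u * c1 + v * c2)) <= exp (Rabs u * (3 * B)) * (Rabs u + Rabs v)).
{ intros y c1 c2 Hy Hc1 Hc2. rewrite Rabs_mult.
  rewrite (Rabs_right (exp _)) by (apply Rle_ge, Rlt_le, exp_pos).
  apply Rmult_le_compat; try apply Rabs_pos; [apply Rlt_le, exp_pos| |].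
  - assert (Hyb : Rabs y <= 3 * B).
    { replace y with ((y - s) + s) by ring. eapply Rle_trans; [apply Rabs_triang|].
      assert (Rabs (t - s) <= Rabs t + Rabs s).
      { eapply Rle_trans; [apply Rabs_triang|]. rewrite Rabs_Ropp. lra. }
      lra. }
    assert (Hle : u * y <= Rabs u * (3 * B)).
    { eapply Rle_trans; [apply Rle_abs|]. rewrite Rabs_mult. apply Rmult_le_compat_l; trivial. }
    destruct Hle as [Hl|Hl]; [apply Rlt_le, exp_increasing; trivial|rewrite Hl; lra].
  - eapply Rle_trans; [apply Rabs_triang|]. rewrite !Rabs_mult.
    assert (Rabs c1 <= 1) by (apply Rabs_le; lra). assert (Rabs c2 <= 1) by (apply Rabs_le; lra).
    apply Rplus_le_compat; rewrite <- Rmult_1_r; apply Rmult_le_compat_l; trivial. }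
split.
- apply (bounded_variation (fun y => exp (u * y) * cos (v * y))
    (fun y => exp (u * y) * (u * cos (v * y) + v * - sin (v * y)))).
  intros y Hy. split; [auto_derive; trivial; ring|].
  pose proof (COS_bound (v * y)). pose proof (SIN_bound (v * y)). apply HD; trivial; lra.
- apply (bounded_variation (fun y => exp (u * y) * sin (v * y))
    (fun y => exp (u * y) * (u * sin (v * y) + v * cos (v * y)))).
  intros y Hy. split; [auto_derive; trivial; ring|].
  pose proof (COS_bound (v * y)). pose proof (SIN_bound (v * y)). apply HD; trivial; lra.
Qed.

Lemma asymptotic_coeff_unique (x : nat -> R) (K d : R) (n : nat) :
  (forall m, 0 < x m) -> is_lim_seq x 0 ->
  eventually (fun m => Rabs (d * x m ^ n) <= K * x m ^ S n) -> d = 0.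
Proof.
intros Hx Hl [m0 Hm].
destruct (Req_dec d 0) as [H|H]; trivial. exfalso. apply Rabs_pos_lt in H.
assert (Hb : forall m, (m0 <= m)%nat -> Rabs d <= K * x m).
{ intros m Hmm. specialize (Hm m Hmm). specialize (Hx m).
  assert (Hp : 0 < x m ^ n) by (apply pow_lt; trivial).
  rewrite Rabs_mult, (Rabs_right (x m ^ n)) in Hm by lra.
  apply Rmult_le_reg_r with (1 := Hp). simpl in Hm. lra. }
assert (HK : is_lim_seq (fun m => K * x m) (K * 0)).
{ apply is_lim_seq_mult'; trivial. apply is_lim_seq_const. }
assert (L := is_lim_seq_le_loc (fun _ => Rabs d) _ (Rabs d) (K * 0) (ex_intro _ m0 Hb)
  (is_lim_seq_const _) HK). simpl in L. lra.
Qed.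

(** Uniqueness of asymptotic coefficients, by strong induction. The coefficients of index n + 1 are
    replaced by the values that the recurrence dictates; [exp_psum] makes the modified truncation
    approximate exp (q H) too, so the discrepancy times x^(n+1) is of order x^(n+2) and must
    vanish. *)
Lemma exp_asymptotic_coeffs (x H : nat -> R) (u v : R) (a b1 b2 : nat -> R) :
  (forall m, 0 < x m <= 1) -> is_lim_seq x 0 ->
  a 0%nat = 0 -> b1 0%nat = 1 -> b2 0%nat = 0 ->
  (forall n, exists C, eventually (fun m => Rabs (H m - psum a (S n) (x m)) <= C * x m ^ S n)) ->
  (forall n, exists C, eventually (fun m =>
     Rabs (exp (u * H m) * cos (v * H m) - psum b1 (S n) (x m)) <= C * x m ^ S n /\
     Rabs (exp (u * H m) * sin (v * H m) - psum b2 (S n) (x m)) <= C * x m ^ S n)) ->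
  forall n, exp_recurrence u v a b1 b2 n.
Proof.
intros Hx Hx0 Ha Hb1 Hb2 HH Hexp n.
induction n as [n IH] using (well_founded_induction lt_wf).
set (B1 := (u * conv (dcoeff a) b1 n - v * conv (dcoeff a) b2 n) / INR (S n)).
set (B2 := (u * conv (dcoeff a) b2 n + v * conv (dcoeff a) b1 n) / INR (S n)).
assert (HSn : INR (S n) <> 0) by (apply not_0_INR; lia).
set (c1 := fun k => if Nat.eq_dec k (S n) then B1 else b1 k).
set (c2 := fun k => if Nat.eq_dec k (S n) then B2 else b2 k).
assert (Hc1 : forall k, (k <= n)%nat -> b1 k = c1 k).
{ intros k Hk. unfold c1. destruct Nat.eq_dec; trivial; lia. }
assert (Hc2 : forall k, (k <= n)%nat -> b2 k = c2 k).
{ intros k Hk. unfold c2. destruct Nat.eq_dec; trivial; lia. }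
assert (Hc1n : c1 (S n) = B1) by (unfold c1; destruct Nat.eq_dec; trivial; lia).
assert (Hc2n : c2 (S n) = B2) by (unfold c2; destruct Nat.eq_dec; trivial; lia).
destruct (exp_psum u v a c1 c2 (S n)) as [K [HK HQ]]; trivial.
{ intros k Hk. unfold exp_recurrence.
  rewrite <- (conv_ext _ b1 c1) by (intros; apply Hc1; lia).
  rewrite <- (conv_ext _ b2 c2) by (intros; apply Hc2; lia).
  destruct (Nat.eq_dec k n) as [->|Hkn].
  - rewrite Hc1n, Hc2n. unfold B1, B2. split; field; trivial.
  - rewrite <- Hc1, <- Hc2 by lia. apply IH; lia. }
destruct (HH (S n)) as [C [m1 HC]].
destruct (Hexp (S n)) as [C' [m2 HC']].
destruct (psum_bound a (S (S n))) as [A [HA HAb]].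
destruct (exp_cos_lipschitz u v (A + Rabs C)) as [L [HL HLip]].
assert (Hev : eventually (fun m =>
  Rabs ((b1 (S n) - c1 (S n)) * x m ^ S n) <= (C' + L * C + K) * x m ^ S (S n) /\
  Rabs ((b2 (S n) - c2 (S n)) * x m ^ S n) <= (C' + L * C + K) * x m ^ S (S n))).
{ exists (m1 + m2)%nat. intros m Hm.
  specialize (HC m ltac:(lia)). specialize (HC' m ltac:(lia)).
  destruct (Hx m) as [Hxm Hxm1].
  specialize (HQ (x m) ltac:(lra)). specialize (HAb (x m) ltac:(lra)).
  set (y := x m) in *. set (P := psum a (S (S n)) y) in *.
  assert (Hyp : 0 < y ^ S (S n)) by (apply pow_lt; trivial).
  assert (Hy1 : y ^ S (S n) <= 1) by (rewrite <- (pow1 (S (S n))); apply pow_incr; lra).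
  assert (HHm : Rabs (H m) <= A + Rabs C).
  { replace (H m) with (P + (H m - P)) by ring. eapply Rle_trans; [apply Rabs_triang|].
    apply Rplus_le_compat; trivial. eapply Rle_trans; [apply HC|].
    eapply Rle_trans; [apply Rmult_le_compat_r; [lra|apply Rle_abs]|].
    rewrite <- Rmult_1_r. apply Rmult_le_compat_l; trivial. apply Rabs_pos. }
  destruct (HLip P (H m)) as [L1 L2]; trivial.
  { pose proof (Rabs_pos C); lra. }
  assert (LC : L * Rabs (H m - P) <= L * (C * y ^ S (S n))) by (apply Rmult_le_compat_l; trivial).
  destruct HC' as [E1 E2]. destruct HQ as [Q1 Q2].
  assert (Hd : forall b c : nat -> R, (forall k, (k <= n)%nat -> b k = c k) ->
    (b (S n) - c (S n)) * y ^ S n = psum b (S (S n)) y - psum c (S (S n)) y).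
  { intros b c Hbc. change (psum ?f (S (S n)) y) with (psum f (S n) y + f (S n) * y ^ S n).
    rewrite (psum_ext b c) by (intros; apply Hbc; lia). ring. }
  assert (Htri : forall p h e q Z1 Z2 Z3, Rabs (h - p) <= Z1 -> Rabs (h - e) <= Z2 -> Rabs (e - q) <= Z3 ->
    Rabs (p - q) <= Z1 + Z2 + Z3).
  { intros p h e q Z1 Z2 Z3 T1 T2 T3. apply Rabs_le_between in T1, T2, T3. apply Rabs_le. lra. }
  rewrite (Hd b1 c1 Hc1), (Hd b2 c2 Hc2).
  replace ((C' + L * C + K) * y ^ S (S n)) with
    (C' * y ^ S (S n) + L * (C * y ^ S (S n)) + K * y ^ S (S n)) by ring.
  split.
  - eapply Htri; [exact E1|eapply Rle_trans; [exact L1|exact LC]|exact Q1].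
  - eapply Htri; [exact E2|eapply Rle_trans; [exact L2|exact LC]|exact Q2]. }
assert (D1 : b1 (S n) - c1 (S n) = 0).
{ apply (asymptotic_coeff_unique x (C' + L * C + K) _ (S n)); trivial; [apply Hx|].
  destruct Hev as [m0 Hm]. exists m0. intros m Hm0. apply (Hm m Hm0). }
assert (D2 : b2 (S n) - c2 (S n) = 0).
{ apply (asymptotic_coeff_unique x (C' + L * C + K) _ (S n)); trivial; [apply Hx|].
  destruct Hev as [m0 Hm]. exists m0. intros m Hm0. apply (Hm m Hm0). }
rewrite Hc1n in D1. rewrite Hc2n in D2.
split; [replace (b1 (S n)) with B1 by lra|replace (b2 (S n)) with B2 by lra]; unfold B1, B2; field; trivial.
Qed.

(** * Factorially divergent coefficients *)

Lemma sum1_shift (f : nat -> R) n : sum1 f (S n) = f 1%nat + sum1 (fun k => f (S k)) n.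
Proof.
induction n as [|n IH]; [simpl; ring|]. rewrite sum1_S, IH, sum1_S. ring.
Qed.

Lemma conv_sum1 (a b : nat -> R) n :
  conv a b n = sum1 (fun j => a (j - 1)%nat * b (S n - j)%nat) n + a n * b 0%nat.
Proof.
revert a. induction n as [|n IH]; intros a; [simpl; ring|].
rewrite sum1_shift.
change (conv a b (S n)) with (a 0%nat * b (S n) + conv (fun i => a (S i)) b n).
rewrite IH. replace (S (S n) - 1)%nat with (S n) by lia.
rewrite (sum1_ext (fun k => a (S k - 1)%nat * _) (fun j => a (S (j - 1)) * b (S n - j)%nat)).
- simpl. ring.
- intros k Hk. replace (S k - 1)%nat with (S (k - 1)) by lia.
  replace (S (S n) - S k)%nat with (S n - k)%nat by lia. reflexivity.
Qed.

Lemma fact_mul_le p q : (1 <= p)%nat -> (1 <= q)%nat ->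
  (fact p * fact q <= fact (p + q - 1))%nat.
Proof.
intros Hp Hq. induction Hp as [|p Hp IH].
- replace (1 + q - 1)%nat with q by lia. simpl. lia.
- replace (S p + q - 1)%nat with (S (p + q - 1)) by lia. rewrite !fact_simpl.
  nia.
Qed.

(** Comparison scale for the a_n. The factor (2 pi)^(-2) is left out so that the powers of 2 pi
    combine exactly in a product of indices j and n - j. *)
Definition growth (n : nat) : R := INR (fact (2 * n - 1)) / (2 * PI) ^ (2 * n).

Lemma growth_pos n : 0 < growth n.
Proof.
apply Rdiv_lt_0_compat; [apply INR_fact_lt_0|apply pow_lt]. pose proof PI_RGT_0; lra.
Qed.

(** By [fact_mul_le] each of the n - 1 products is at most (2 n - 3)! / (2 pi)^(2 n), and n (n - 1)
    <= (2 n - 1) (2 n - 2). *)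
Lemma growth_conv n : (1 <= n)%nat ->
  sum1 (fun j => growth j * growth (n - j)) (n - 1) <= growth n / INR n.
Proof.
intros Hn. destruct n as [|[|n]]; [lia| |].
{ simpl sum1. apply Rlt_le, Rdiv_lt_0_compat; [apply growth_pos|apply lt_0_INR; lia]. }
set (N := S (S n)). pose proof PI_RGT_0 as HPI.
assert (HpN : 0 < / (2 * PI) ^ (2 * N)) by (apply Rinv_0_lt_compat, pow_lt; lra).
apply Rle_trans with (sum1 (fun _ => INR (fact (2 * n + 1)) * / (2 * PI) ^ (2 * N) * 1) (N - 1)).
- assert (H : forall f g M, (forall j, (1 <= j <= M)%nat -> f j <= g j) -> sum1 f M <= sum1 g M).
  { intros f g M. induction M as [|M IHM]; simpl; [lra|]. intros Hfg.
    apply Rplus_le_compat; [apply IHM; intros; apply Hfg|apply Hfg]; lia. }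
  apply H. intros j Hj. unfold growth. rewrite Rmult_1_r.
  replace (2 * N)%nat with (2 * j + 2 * (N - j))%nat by lia. rewrite pow_add.
  set (X := INR (fact (2 * j - 1))). set (Y := INR (fact (2 * (N - j) - 1))).
  replace (X / (2 * PI) ^ (2 * j) * (Y / (2 * PI) ^ (2 * (N - j)))) with
    (X * Y * / ((2 * PI) ^ (2 * j) * (2 * PI) ^ (2 * (N - j)))).
  2:{ field. split; apply pow_nonzero; lra. }
  apply Rmult_le_compat_r.
  + apply Rlt_le, Rinv_0_lt_compat, Rmult_lt_0_compat; apply pow_lt; lra.
  + unfold X, Y. rewrite <- mult_INR. apply le_INR.
    eapply Nat.le_trans; [apply fact_mul_le; lia|].
    replace (2 * j - 1 + (2 * (N - j) - 1) - 1)%nat with (2 * n + 1)%nat by (unfold N; lia). lia.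
- rewrite sum1_scal.
  assert (E1 : forall M, sum1 (fun _ => 1) M = INR M).
  { induction M as [|M IHM]; [reflexivity|]. rewrite sum1_S, IHM, S_INR. ring. }
  rewrite E1. unfold growth.
  replace (2 * N - 1)%nat with (S (S (2 * n + 1))) by (unfold N; lia).
  rewrite !fact_simpl, !mult_INR.
  replace (N - 1)%nat with (S n) by (unfold N; lia).
  assert (HN : INR N = INR n + 2) by (unfold N; rewrite !S_INR; ring).
  rewrite HN, !S_INR, plus_INR, mult_INR. change (INR 1) with 1. change (INR 2) with 2.
  pose proof (pos_INR n) as Hn0. pose proof (INR_fact_lt_0 (2 * n + 1)) as Hf.
  set (f := INR (fact (2 * n + 1))) in *. set (w := / (2 * PI) ^ (2 * N)) in *.
  set (t := INR n) in *.
  replace ((2 * t + 1 + 1 + 1) * ((2 * t + 1 + 1) * f) / (2 * PI) ^ (2 * N) / (t + 2)) with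
    (f * w * ((2 * t + 3) * (2 * t + 2) / (t + 2))).
  2:{ unfold w. field. split; [apply pow_nonzero|]; lra. }
  apply Rmult_le_compat_l; [apply Rlt_le, Rmult_lt_0_compat; trivial|].
  apply Rmult_le_reg_r with (t + 2); [lra|].
  replace ((2 * t + 3) * (2 * t + 2) / (t + 2) * (t + 2)) with ((2 * t + 3) * (2 * t + 2)) by (field; lra).
  nra.
Qed.

(** [conv_sum1] isolates the term (n + 1) a_(n+1) b_0; after division by n + 1 the other terms j a_j
    b_(n+1-j) have weight j / (n + 1) <= 1, and [growth_conv] applies. *)
Lemma conv_growth_bound (a b : nat -> R) (A K : R) n : 0 <= A -> 0 <= K ->
  (forall j, (1 <= j)%nat -> Rabs (a j) <= A * growth j) ->
  (forall j, (1 <= j <= n)%nat -> Rabs (b j) <= K * growth j) ->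
  Rabs (conv (dcoeff a) b n / INR (S n) - a (S n) * b 0%nat)
  <= A * K * growth (S n) / INR (S n).
Proof.
intros HA HK Ha Hb.
assert (HSn : 0 < INR (S n)) by (apply lt_0_INR; lia).
rewrite conv_sum1. unfold dcoeff at 2.
replace ((_ + _) / _ - _) with (/ INR (S n) * sum1 (fun j => dcoeff a (j - 1) * b (S n - j)%nat) n).
2:{ field. lra. }
rewrite <- sum1_scal.
apply Rle_trans with (sum1 (fun j => A * K * (growth j * growth (S n - j))) n).
- apply sum1_Rabs_le. intros j Hj. unfold dcoeff.
  replace (S (j - 1)) with j by lia.
  assert (Hj1 : INR j <= INR (S n)) by (apply le_INR; lia).
  assert (Hj0 : 0 < INR j) by (apply lt_0_INR; lia).
  rewrite !Rabs_mult, (Rabs_right (/ _)) by (apply Rle_ge, Rlt_le, Rinv_0_lt_compat; trivial).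
  rewrite (Rabs_right (INR j)) by lra.
  replace (/ INR (S n) * (INR j * Rabs (a j) * Rabs (b (S n - j)%nat))) with
    ((INR j / INR (S n)) * (Rabs (a j) * Rabs (b (S n - j)%nat))) by (field; lra).
  rewrite <- (Rmult_1_l (A * K * _)).
  replace (A * K * (growth j * growth (S n - j))) with ((A * growth j) * (K * growth (S n - j))) by ring.
  apply Rmult_le_compat.
  + apply Rmult_le_pos; [lra|]. apply Rlt_le, Rinv_0_lt_compat; trivial.
  + apply Rmult_le_pos; apply Rabs_pos.
  + apply Rmult_le_reg_r with (INR (S n)); trivial. field_simplify; lra.
  + apply Rmult_le_compat; try apply Rabs_pos; [apply Ha|apply Hb]; lia.
- rewrite sum1_scal.
  replace (A * K * growth (S n) / INR (S n)) with (A * K * (growth (S n) / INR (S n))) by (unfold Rdiv; ring).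
  apply Rmult_le_compat_l; [apply Rmult_le_pos; trivial|].
  pose proof (growth_conv (S n) ltac:(lia)) as H.
  replace (S n - 1)%nat with n in H by lia. exact H.
Qed.

Lemma finite_growth_bound (b1 b2 : nat -> R) N : exists K, 0 <= K /\
  forall n, (n < N)%nat -> Rabs (b1 n) <= K * growth n /\ Rabs (b2 n) <= K * growth n.
Proof.
induction N as [|N [K [HK IH]]]; [exists 0; split; [lra|lia]|].
set (K' := (Rabs (b1 N) + Rabs (b2 N)) / growth N).
pose proof (growth_pos N) as Hg. pose proof (Rabs_pos (b1 N)). pose proof (Rabs_pos (b2 N)).
assert (HK' : 0 <= K') by (apply Rmult_le_pos; [lra|apply Rlt_le, Rinv_0_lt_compat; trivial]).
exists (K + K'). split; [lra|]. intros n Hn.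
pose proof (growth_pos n) as Hgn. rewrite Rmult_plus_distr_r.
assert (0 <= K * growth n) by (apply Rmult_le_pos; lra).
assert (0 <= K' * growth n) by (apply Rmult_le_pos; lra).
destruct (Nat.eq_dec n N) as [->|Hne].
- assert (K' * growth N = Rabs (b1 N) + Rabs (b2 N)) by (unfold K'; field; lra).
  split; lra.
- destruct (IH n ltac:(lia)). split; lra.
Qed.

(* Because [growth] is faster than exponential, the terms of the convolution
   other than [a (n + 1) b 0] are negligible (Bender's argument). *)
Lemma exp_recurrence_growth (u v A : R) (a b1 b2 : nat -> R) : 0 <= A ->
  b1 0%nat = 1 -> b2 0%nat = 0 ->
  (forall j, (1 <= j)%nat -> Rabs (a j) <= A * growth j) ->
  (forall n, exp_recurrence u v a b1 b2 n) ->
  exists K, 0 <= K /\ forall n, (1 <= n)%nat ->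
  Rabs (b1 n - u * a n) <= K * growth n / INR n /\
  Rabs (b2 n - v * a n) <= K * growth n / INR n.
Proof.
intros HA Hb1 Hb2 Ha Hrec. set (L := Rabs u + Rabs v).
pose proof (Rabs_pos u) as Hu0. pose proof (Rabs_pos v) as Hv0.
assert (HLA : 0 <= L * A) by (apply Rmult_le_pos; unfold L; lra).
(* A bound on the earlier coefficients yields the estimate at n + 1 with an extra factor 1 / (n +
   1); it serves first to bound all coefficients, then as the conclusion. *)
assert (Hstep : forall K n, 0 <= K ->
  (forall j, (1 <= j <= n)%nat -> Rabs (b1 j) <= K * growth j /\ Rabs (b2 j) <= K * growth j) ->
  Rabs (b1 (S n) - u * a (S n)) <= L * A * K * growth (S n) / INR (S n) /\
  Rabs (b2 (S n) - v * a (S n)) <= L * A * K * growth (S n) / INR (S n)).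
{ intros K n HK Hb.
  pose proof (conv_growth_bound a b1 A K n HA HK Ha (fun j Hj => proj1 (Hb j Hj))) as C1.
  pose proof (conv_growth_bound a b2 A K n HA HK Ha (fun j Hj => proj2 (Hb j Hj))) as C2.
  rewrite Hb1 in C1. rewrite Hb2 in C2.
  destruct (Hrec n) as [R1 R2].
  assert (HSn : 0 < INR (S n)) by (apply lt_0_INR; lia).
  set (X1 := conv (dcoeff a) b1 n) in *. set (X2 := conv (dcoeff a) b2 n) in *.
  set (Z := A * K * growth (S n) / INR (S n)) in *.
  replace (L * A * K * growth (S n) / INR (S n)) with (Rabs u * Z + Rabs v * Z).
  2:{ unfold L, Z. field. lra. }
  assert (HM : forall s t y z : R, Rabs y <= Z -> Rabs z <= Z -> Rabs (s * y + t * z) <= Rabs s * Z + Rabs t * Z).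
  { intros s t y z Hy Hz. eapply Rle_trans; [apply Rabs_triang|]. rewrite !Rabs_mult.
    apply Rplus_le_compat; apply Rmult_le_compat_l; trivial; apply Rabs_pos. }
  split.
  - replace (b1 (S n) - u * a (S n)) with
      (u * (X1 / INR (S n) - a (S n) * 1) + - v * (X2 / INR (S n) - a (S n) * 0)).
    + eapply Rle_trans; [apply HM; [exact C1|exact C2]|]. rewrite Rabs_Ropp. lra.
    + replace (b1 (S n)) with ((u * X1 - v * X2) / INR (S n)) by (rewrite <- R1; field; lra).
      field. lra.
  - replace (b2 (S n) - v * a (S n)) with
      (u * (X2 / INR (S n) - a (S n) * 0) + v * (X1 / INR (S n) - a (S n) * 1)).
    + apply HM; [exact C2|exact C1].
    + replace (b2 (S n)) with ((u * X2 + v * X1) / INR (S n)) by (rewrite <- R2; field; lra).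
      field. lra. }
(* Beyond [N0] the factor L A / (n + 1) is below 1/2, so the convolution contributes at most half of
   K; the other half absorbs the main term because K >= 2 L A. The summand [K0] covers the indices
   up to [N0]. *)
destruct (INR_unbounded (2 * (L * A))) as [N0 HN0].
destruct (finite_growth_bound b1 b2 (S N0)) as [K0 [HK0 Hfin]].
set (K := K0 + 2 * (L * A)).
assert (HK : 0 <= K) by (unfold K; lra).
assert (Hall : forall n, (1 <= n)%nat -> Rabs (b1 n) <= K * growth n /\ Rabs (b2 n) <= K * growth n).
{ intros n. induction n as [n IH] using (well_founded_induction lt_wf). intros Hn.
  pose proof (growth_pos n) as Hg.
  destruct (le_lt_dec n N0) as [Hle|Hlt].
  - destruct (Hfin n ltac:(lia)) as [F1 F2].
    assert (K0 * growth n <= K * growth n) by (apply Rmult_le_compat_r; unfold K; lra).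
    split; lra.
  - destruct n as [|n]; [lia|].
    destruct (Hstep K n HK) as [S1 S2]; [intros j Hj; apply IH; lia|].
    assert (HN : INR N0 <= INR (S n)) by (apply le_INR; lia).
    assert (HSn : 0 < INR (S n)) by (apply lt_0_INR; lia).
    assert (Hhalf : L * A * K * growth (S n) / INR (S n) <= K / 2 * growth (S n)).
    { apply Rmult_le_reg_r with (INR (S n)); trivial.
      replace (L * A * K * growth (S n) / INR (S n) * INR (S n)) with ((L * A) * (K * growth (S n))) by (field; lra).
      replace (K / 2 * growth (S n) * INR (S n)) with ((INR (S n) / 2) * (K * growth (S n))) by field.
      apply Rmult_le_compat_r; [apply Rmult_le_pos|]; lra. }
    assert (Hmain : forall w, Rabs w <= L -> Rabs (w * a (S n)) <= K / 2 * growth (S n)).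
    { intros w Hw. rewrite Rabs_mult. apply Rle_trans with (L * (A * growth (S n))).
      - apply Rmult_le_compat; try apply Rabs_pos; trivial. apply Ha; lia.
      - rewrite <- Rmult_assoc. apply Rmult_le_compat_r; unfold K; lra. }
    pose proof (Hmain u ltac:(unfold L; lra)). pose proof (Hmain v ltac:(unfold L; lra)).
    split.
    + replace (b1 (S n)) with ((b1 (S n) - u * a (S n)) + u * a (S n)) by ring.
      eapply Rle_trans; [apply Rabs_triang|]. lra.
    + replace (b2 (S n)) with ((b2 (S n) - v * a (S n)) + v * a (S n)) by ring.
      eapply Rle_trans; [apply Rabs_triang|]. lra. }
exists (L * A * K). split; [apply Rmult_le_pos; trivial|].
intros [|n] Hn; [lia|]. apply Hstep; trivial. intros j Hj. apply Hall; lia.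
Qed.

(** The subtracted term is k = 1; for k >= 2, k^(-2i-2) <= 4^(-i) k^(-2), and the tail of sum 1 /
    k^2 after 1 is at most 1. *)
Lemma freq_zeta_approx i :
  Rabs (freq_zeta i - / (2 * PI) ^ (2 * i + 2)) <= (/ 4) ^ i / (2 * PI) ^ (2 * i + 2).
Proof.
pose proof PI_RGT_0 as HPI.
set (w := / (2 * PI) ^ (2 * i + 2)).
assert (Hw : 0 < w) by (apply Rinv_0_lt_compat, pow_lt; lra).
assert (Hf1 : freq_sum i 1 = w).
{ unfold freq_sum, freq, w. simpl sum1. rewrite Rplus_0_l, Rmult_1_r. reflexivity. }
rewrite <- Hf1 at 1. fold w.
assert (L : is_lim_seq (fun K => Rabs (freq_sum i K - freq_sum i 1)) (Rabs (freq_zeta i - freq_sum i 1))).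
{ apply (is_lim_seq_abs _ (Finite _)). apply is_lim_seq_minus'; [apply is_lim_freq_sum|apply is_lim_seq_const]. }
replace ((/ 4) ^ i / (2 * PI) ^ (2 * i + 2)) with ((/ 4) ^ i * w) by reflexivity.
refine (is_lim_seq_le_loc _ (fun _ => (/ 4) ^ i * w) _ _ _ L (is_lim_seq_const _)).
exists 1%nat. intros K HK.
replace ((/ 4) ^ i * w) with ((/ 4) ^ i * w / INR 1) by (simpl; field).
assert (H4 : 0 < (/ 4) ^ i) by (apply pow_lt; lra).
apply sum1_tail_le; [apply Rmult_le_pos; lra| |lia].
intros k Hk. assert (Hk2 : 2 <= INR k) by (apply (le_INR 2); lia).
assert (H0 : 0 < / freq k ^ (2 * i + 2)) by (apply freq_pow_bound; lia).
rewrite Rabs_right by lra. unfold freq. rewrite Rpow_mult_distr, (pow_add (INR k)).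
unfold w, Rdiv. rewrite !Rinv_mult.
replace ((/ 4) ^ i * / (2 * PI) ^ (2 * i + 2) * / INR k ^ 2) with
  (/ (2 * PI) ^ (2 * i + 2) * ((/ 4) ^ i * / INR k ^ 2)) by ring.
apply Rmult_le_compat_l; [apply Rlt_le; exact Hw|].
apply Rmult_le_compat_r; [apply Rlt_le, Rinv_0_lt_compat, pow_lt; lra|].
rewrite pow_inv. apply Rinv_le_contravar; [apply pow_lt; lra|].
rewrite pow_mult. apply pow_incr. nra.
Qed.

Lemma barnes_coeff_approx n :
  Rabs (barnes_coeff n - (-1) ^ n * (2 * INR (fact (2 * n - 1))) / (2 * PI) ^ (2 * n + 2))
  <= (/ 4) ^ n * (2 * growth n / (2 * PI) ^ 2).
Proof.
pose proof PI_RGT_0 as HPI. pose proof (freq_zeta_approx n) as H.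
pose proof (INR_fact_lt_0 (2 * n - 1)) as Hf.
unfold barnes_coeff, growth.
set (f := INR (fact (2 * n - 1))) in *.
replace (_ - _) with (((-1) ^ n * (2 * f)) * (freq_zeta n - / (2 * PI) ^ (2 * n + 2))) by (unfold Rdiv; ring).
rewrite Rabs_mult, Rabs_mult, pow_1_abs, Rmult_1_l, Rabs_right by lra.
eapply Rle_trans; [apply Rmult_le_compat_l; [lra|exact H]|].
rewrite pow_add. apply Req_le. field. repeat split; try apply pow_nonzero; lra.
Qed.

(** The leading term is at most 2 [growth n], as (2 pi)^2 >= 1, and the error is no larger. *)
Lemma barnes_coeff_bound n : (1 <= n)%nat -> Rabs (barnes_coeff n) <= 4 * growth n.
Proof.
intros Hn. pose proof (barnes_coeff_approx n) as H. pose proof PI_RGT_0. pose proof PI2_1.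
pose proof (growth_pos n) as Hg. pose proof (INR_fact_lt_0 (2 * n - 1)) as Hf.
set (g := (-1) ^ n * (2 * INR (fact (2 * n - 1))) / (2 * PI) ^ (2 * n + 2)) in *.
assert (Eg : Rabs g = 2 * growth n / (2 * PI) ^ 2).
{ unfold g, Rdiv, growth. rewrite !Rabs_mult, pow_1_abs.
  rewrite (Rabs_right 2), (Rabs_right (INR _)), (Rabs_right (/ _)) by
    first [lra | apply Rle_ge, Rlt_le, Rinv_0_lt_compat, pow_lt; lra].
  rewrite pow_add. field. repeat split; try apply pow_nonzero; lra. }
assert (Hs : 2 * growth n / (2 * PI) ^ 2 <= 2 * growth n).
{ rewrite <- (Rmult_1_r (2 * growth n)) at 2. apply Rmult_le_compat_l; [lra|].
  rewrite <- Rinv_1. apply Rinv_le_contravar; [lra|]. nra. }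
assert (Hs0 : 0 <= 2 * growth n / (2 * PI) ^ 2) by (rewrite <- Eg; apply Rabs_pos).
assert (H4 : (/ 4) ^ n <= 1) by (rewrite <- (pow1 n); apply pow_incr; lra).
replace (barnes_coeff n) with ((barnes_coeff n - g) + g) by ring.
eapply Rle_trans; [apply Rabs_triang|]. rewrite Eg.
assert ((/ 4) ^ n * (2 * growth n / (2 * PI) ^ 2) <= 1 * (2 * growth n / (2 * PI) ^ 2)).
{ apply Rmult_le_compat_r; trivial. }
lra.
Qed.

(** * The Weierstrass products at the positive integers *)

Lemma sum_n_m_sum1 (f : nat -> R) n : sum_n_m f 1 n = sum1 f n.
Proof.
induction n as [|n IH].
- rewrite sum_n_m_zero by lia. reflexivity.
- rewrite sum_n_Sm, IH by lia. reflexivity.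
Qed.

Lemma ln_1p_bound1 t : 0 <= t -> Rabs (t - ln (1 + t)) <= t ^ 2.
Proof.
intros Ht.
assert (H := flat_at_zero (fun t => t - ln (1 + t)) (fun t => t / (1 + t)) 1 t 1 ltac:(lra)).
cbv beta in H. rewrite Rplus_0_r, ln_1 in H.
replace (t - ln (1 + t)) with (t - ln (1 + t) - (0 - 0)) by ring.
replace (t ^ 2) with (1 * t ^ 2) by ring.
apply H; try lra.
- intros x Hx. auto_derive; [lra|field; lra].
- intros x Hx. unfold Rdiv. rewrite Rabs_right.
  + rewrite Rmult_1_l, pow_1. apply Rle_trans with (x * 1); [apply Rmult_le_compat_l; [lra|]|lra].
    rewrite <- Rinv_1. apply Rinv_le_contravar; lra.
  + apply Rle_ge, Rmult_le_pos; [lra|apply Rlt_le, Rinv_0_lt_compat; lra].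
Qed.

Lemma ln_1p_bound2 t : 0 <= t -> Rabs (ln (1 + t) - t + t ^ 2 / 2) <= t ^ 3.
Proof.
intros Ht.
assert (H := flat_at_zero (fun t => ln (1 + t) - t + t ^ 2 / 2) (fun t => t ^ 2 / (1 + t)) 1 t 2
  ltac:(lra)).
cbv beta in H. rewrite Rplus_0_r, ln_1 in H.
replace (ln (1 + t) - t + t ^ 2 / 2) with
  (ln (1 + t) - t + t ^ 2 / 2 - (0 - 0 + 0 ^ 2 / 2)) by field.
replace (t ^ 3) with (1 * t ^ 3) by ring.
apply H; try lra.
- intros x Hx. auto_derive; [lra|field; lra].
- intros x Hx. assert (0 <= x ^ 2) by (apply pow_le; lra).
  unfold Rdiv. rewrite Rabs_right.
  + rewrite Rmult_1_l. apply Rle_trans with (x ^ 2 * 1); [apply Rmult_le_compat_l; [lra|]|lra].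
    rewrite <- Rinv_1. apply Rinv_le_contravar; lra.
  + apply Rle_ge, Rmult_le_pos; [lra|apply Rlt_le, Rinv_0_lt_compat; lra].
Qed.

(** Logarithms of the Weierstrass factors. Gamma (m + 1) uses its product at z = m + 1, whereas the
    product for G (m + 1) is in w = m; hence [S m] here and m in [barnes_term]. *)
Definition gamma_term (m k : nat) : R :=
  INR (S m) / INR k - ln (1 + INR (S m) / INR k).

Definition barnes_term (m k : nat) : R :=
  INR k * ln (1 + INR m / INR k) + INR m ^ 2 / (2 * INR k) - INR m.

Definition gamma_sum (m : nat) : R := real (Lim_seq (sum1 (gamma_term m))).

Definition barnes_sum (m : nat) : R := real (Lim_seq (sum1 (barnes_term m))).

Lemma is_lim_real (f : nat -> R) : ex_finite_lim_seq f -> is_lim_seq f (real (Lim_seq f)).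
Proof. intros [l Hl]. rewrite (is_lim_seq_unique _ _ Hl). exact Hl. Qed.

Lemma is_lim_gamma_sum m : is_lim_seq (sum1 (gamma_term m)) (gamma_sum m).
Proof.
apply is_lim_real, (sum1_ex_lim _ (INR (S m) ^ 2)). intros k Hk.
assert (0 < INR k) by (apply lt_0_INR; lia).
eapply Rle_trans; [apply ln_1p_bound1|].
- apply Rmult_le_pos; [apply pos_INR|apply Rlt_le, Rinv_0_lt_compat; trivial].
- apply Req_le. field. lra.
Qed.

Lemma is_lim_barnes_sum m : is_lim_seq (sum1 (barnes_term m)) (barnes_sum m).
Proof.
apply is_lim_real, (sum1_ex_lim _ (INR m ^ 3)). intros k Hk.
assert (0 < INR k) by (apply lt_0_INR; lia).
unfold barnes_term.
replace (_ - _) with (INR k * (ln (1 + INR m / INR k) - INR m / INR k + (INR m / INR k) ^ 2 / 2)) by (field; lra).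
rewrite Rabs_mult, (Rabs_right (INR k)) by lra.
replace (INR m ^ 3 / INR k ^ 2) with (INR k * (INR m / INR k) ^ 3) by (field; lra).
apply Rmult_le_compat_l; [lra|]. apply ln_1p_bound2.
apply Rmult_le_pos; [apply pos_INR|apply Rlt_le, Rinv_0_lt_compat; trivial].
Qed.

Lemma ln_shift_split a k : 0 <= a -> (1 <= k)%nat ->
  ln (1 + a / INR k) = ln (INR k + a) - ln (INR k).
Proof.
intros Ha Hk. assert (0 < INR k) by (apply lt_0_INR; lia).
rewrite <- ln_div by lra. f_equal. field. lra.
Qed.

Lemma is_lim_ln_shift (a b : R) : 0 <= a -> 0 <= b ->
  is_lim_seq (fun K => ln (INR K + a) - ln (INR K + b)) 0.
Proof.
intros Ha Hb.
assert (H : forall c, 0 <= c -> is_lim_seq (fun K => ln (INR K + c) - ln (INR K)) 0).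
{ intros c Hc. apply (is_lim_seq_le_le_loc (fun _ => 0) _ (fun K => (c + c ^ 2) / INR K)).
  - exists 1%nat. intros K HK. assert (HK1 : 1 <= INR K) by (apply (le_INR 1); trivial).
    rewrite <- ln_shift_split by trivial.
    assert (Hck : 0 <= c / INR K) by (apply Rmult_le_pos; [trivial|apply Rlt_le, Rinv_0_lt_compat; lra]).
    split.
    + rewrite <- ln_1. destruct Hck as [Hck|Hck].
      * apply Rlt_le, ln_increasing; lra.
      * rewrite <- Hck, Rplus_0_r. lra.
    + pose proof (ln_1p_bound1 _ Hck) as B. apply Rabs_le_between in B.
      assert ((c / INR K) ^ 2 <= c ^ 2 / INR K).
      { replace ((c / INR K) ^ 2) with (c ^ 2 * / (INR K ^ 2)) by (field; lra).
        apply Rmult_le_compat_l; [apply pow_le; trivial|].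
        apply Rinv_le_contravar; nra. }
      unfold Rdiv in *. lra.
  - apply is_lim_seq_const.
  - apply is_lim_seq_div_INR. }
apply (is_lim_seq_ext (fun K => (ln (INR K + a) - ln (INR K)) - (ln (INR K + b) - ln (INR K)))).
{ intros; ring. }
replace 0 with (0 - 0) by ring. apply is_lim_seq_minus'; auto.
Qed.

(** The partial sums of [gamma_term 0] are the harmonic sums minus ln (K + 1), which gives
    convergence; moving the shift inside the logarithm changes nothing in the limit. *)
Lemma is_lim_harmonic (a : R) : 0 <= a ->
  is_lim_seq (fun K => sum1 (fun k => / INR k) K - ln (INR K + a)) euler_gamma.
Proof.
intros Ha.
assert (E : forall K, sum1 (gamma_term 0) K = sum1 (fun k => / INR k) K - ln (INR K + 1)).
{ induction K as [|K IH].
  - simpl. rewrite Rplus_0_l, ln_1. ring.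
  - rewrite !sum1_S, IH. unfold gamma_term. rewrite ln_shift_split by (simpl; lra || lia).
    change (INR 1) with 1. rewrite <- S_INR. field. apply not_0_INR; lia. }
assert (H : forall c, 0 <= c ->
  is_lim_seq (fun K => sum1 (fun k => / INR k) K - ln (INR K + c)) (gamma_sum 0)).
{ intros c Hc.
  apply (is_lim_seq_ext (fun K => sum1 (gamma_term 0) K - (ln (INR K + c) - ln (INR K + 1)))).
  { intros K. rewrite E. ring. }
  replace (gamma_sum 0) with (gamma_sum 0 - 0) by ring.
  apply is_lim_seq_minus'; [apply is_lim_gamma_sum|apply is_lim_ln_shift; lra]. }
replace euler_gamma with (gamma_sum 0); [auto|].
unfold euler_gamma. symmetry.
change (gamma_sum 0) with (real (Finite (gamma_sum 0))). f_equal. apply is_lim_seq_unique.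
apply (is_lim_seq_ext (fun K => sum1 (fun k => / INR k) K - ln (INR K + 0))); [|apply H; lra].
intros K. rewrite Rplus_0_r, sum_n_m_sum1. reflexivity.
Qed.

(** The functional equation of Gamma: the logarithms telescope in k, leaving a harmonic sum minus ln
    (K + m + 2). *)
Lemma gamma_sum_step m : gamma_sum (S m) - gamma_sum m = euler_gamma + ln (INR m + 2).
Proof.
assert (E : forall K, sum1 (gamma_term (S m)) K - sum1 (gamma_term m) K =
  (sum1 (fun k => / INR k) K - ln (INR K + (INR m + 2))) + ln (INR m + 2)).
{ induction K as [|K IH].
  - simpl. rewrite Rplus_0_l. ring.
  - rewrite !sum1_S.
    replace (sum1 (gamma_term (S m)) K) with
     (sum1 (gamma_term m) K + (sum1 (fun k => / INR k) K - ln (INR K + (INR m + 2)) + ln (INR m + 2)))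
     by (rewrite <- IH; ring).
    unfold gamma_term. rewrite !ln_shift_split by (try lia; apply pos_INR).
    replace (INR (S K) + INR (S m)) with (INR K + (INR m + 2)) by (rewrite !S_INR; ring).
    replace (INR (S K) + INR (S (S m))) with (INR (S K) + (INR m + 2)) by (rewrite !S_INR; ring).
    rewrite (S_INR (S m)). field. apply not_0_INR; lia. }
assert (L1 := is_lim_seq_minus' _ _ _ _ (is_lim_gamma_sum (S m)) (is_lim_gamma_sum m)).
assert (Hm : 0 <= INR m + 2) by (pose proof (pos_INR m); lra).
assert (L2 := is_lim_seq_plus' _ _ _ _ (is_lim_harmonic _ Hm) (is_lim_seq_const (ln (INR m + 2)))).
apply (is_lim_seq_ext _ _ _ E) in L1.
apply is_lim_seq_unique in L1. apply is_lim_seq_unique in L2. rewrite L1 in L2.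
injection L2. trivial.
Qed.

(** Limit of the boundary term of the summation by parts in [barnes_sum_step2]; the logarithmic
    difference lies between 1 / (K + a + 1) and 1 / (K + a). *)
Lemma is_lim_mul_ln_step (a : R) : 0 <= a ->
  is_lim_seq (fun K => INR K * (ln (INR K + (a + 1)) - ln (INR K + a))) 1.
Proof.
intros Ha.
apply (is_lim_seq_le_le_loc (fun K => 1 - (a + 1) / INR K) _ (fun _ => 1)).
- exists 1%nat. intros K HK. assert (HK1 : 1 <= INR K) by (apply (le_INR 1); trivial).
  set (x := INR K) in *.
  assert (Hup : ln (x + (a + 1)) - ln (x + a) <= / (x + a)).
  { rewrite <- ln_div by lra.
    replace ((x + (a + 1)) / (x + a)) with (1 + / (x + a)) by (field; lra).
    assert (0 < / (x + a)) by (apply Rinv_0_lt_compat; lra).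
    apply Rlt_le, exp_lt_inv. rewrite exp_ln by lra. apply exp_ineq1. lra. }
  assert (Hlo : / (x + (a + 1)) <= ln (x + (a + 1)) - ln (x + a)).
  { replace (ln (x + (a + 1)) - ln (x + a)) with (- (ln (x + a) - ln (x + (a + 1)))) by ring.
    rewrite <- ln_div by lra.
    replace ((x + a) / (x + (a + 1))) with (1 + - / (x + (a + 1))) by (field; lra).
    assert (Hi : 0 < / (x + (a + 1)) < 1).
    { split; [apply Rinv_0_lt_compat; lra|]. rewrite <- Rinv_1. apply Rinv_lt_contravar; lra. }
    cut (ln (1 + - / (x + (a + 1))) < - / (x + (a + 1))); [lra|].
    apply exp_lt_inv. rewrite exp_ln by lra. apply exp_ineq1. lra. }
  split.
  + apply Rle_trans with (x * / (x + (a + 1))); [|apply Rmult_le_compat_l; lra].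
    replace (x * / (x + (a + 1))) with (1 - (a + 1) / (x + (a + 1))) by (field; lra).
    cut ((a + 1) / (x + (a + 1)) <= (a + 1) / x); [lra|].
    apply Rmult_le_compat_l; [lra|]. apply Rinv_le_contravar; lra.
  + apply Rle_trans with (x * / (x + a)); [apply Rmult_le_compat_l; lra|].
    apply Rmult_le_reg_r with (x + a); [lra|]. field_simplify; lra.
- assert (L := is_lim_seq_minus' _ _ _ _ (is_lim_seq_const 1) (is_lim_seq_div_INR (a + 1))).
  rewrite Rminus_0_r in L. exact L.
- apply is_lim_seq_const.
Qed.

(* Summation by parts evaluates the partial sums of the second difference. *)
Lemma barnes_sum_step2 m :
  barnes_sum (S (S m)) - 2 * barnes_sum (S m) + barnes_sum m =
  1 + euler_gamma + ln (INR m + 1).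
Proof.
assert (Hm : 0 <= INR m + 1) by (pose proof (pos_INR m); lra).
set (F := fun K => INR K * (ln (INR K + (INR m + 1 + 1)) - ln (INR K + (INR m + 1)))
  + (sum1 (fun k => / INR k) K - ln (INR K + (INR m + 1))) + ln (INR m + 1)).
assert (E : forall K, sum1 (barnes_term (S (S m))) K - 2 * sum1 (barnes_term (S m)) K
  + sum1 (barnes_term m) K = F K).
{ induction K as [|K IH].
  - unfold F. simpl. rewrite !Rplus_0_l. ring.
  - rewrite !sum1_S.
    replace (sum1 (barnes_term m) K) with (F K - sum1 (barnes_term (S (S m))) K
      + 2 * sum1 (barnes_term (S m)) K) by (rewrite <- IH; ring).
    unfold barnes_term, F. rewrite !ln_shift_split by (try lia; apply pos_INR).
    rewrite sum1_S.
    replace (INR (S K) + INR m) with (INR K + (INR m + 1)) by (rewrite !S_INR; ring).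
    replace (INR (S K) + INR (S m)) with (INR K + (INR m + 1 + 1)) by (rewrite !S_INR; ring).
    replace (INR (S K) + INR (S (S m))) with (INR (S K) + (INR m + 1 + 1)) by (rewrite !S_INR; ring).
    replace (INR (S K) + (INR m + 1)) with (INR K + (INR m + 1 + 1)) by (rewrite !S_INR; ring).
    rewrite !(S_INR m), !(S_INR (S m)), !(S_INR m), !(S_INR K).
    field. pose proof (pos_INR K). lra. }
assert (L1 := is_lim_seq_plus' _ _ _ _ (is_lim_seq_minus' _ _ _ _ (is_lim_barnes_sum (S (S m)))
   (is_lim_seq_mult' _ _ _ _ (is_lim_seq_const 2) (is_lim_barnes_sum (S m)))) (is_lim_barnes_sum m)).
assert (L2 := is_lim_seq_plus' _ _ _ _ (is_lim_seq_plus' _ _ _ _ (is_lim_mul_ln_step _ Hm)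
   (is_lim_harmonic _ Hm)) (is_lim_seq_const (ln (INR m + 1)))).
apply (is_lim_seq_ext _ F _ E) in L1.
apply is_lim_seq_unique in L1. apply is_lim_seq_unique in L2.
assert (L3 := eq_trans (eq_sym L1) L2). injection L3. trivial.
Qed.

(** * The logarithm of the ratio at the integers and its recurrence *)

Definition log_barnes (m : nat) : R :=
  INR m / 2 * ln (2 * PI) - (INR m + (1 + euler_gamma) * INR m ^ 2) / 2 + barnes_sum m.

Definition log_fact (m : nat) : R :=
  - euler_gamma * (INR m + 1) - ln (INR m + 1) + gamma_sum m.

Definition log_ratio (m : nat) : R :=
  log_barnes m + (INR m ^ 2 / 2 + INR m / 2 + 1 / 12) * ln (INR m) - INR m ^ 2 / 4
  - INR m * log_fact m.

(* Evaluating [c], which is 0, would require Stirling's formula. *)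
Lemma log_ratio_step : exists c, forall m, (1 <= m)%nat ->
  log_ratio (S m) - log_ratio m = barnes_step (INR m) + c.
Proof.
assert (Hf : forall m, log_fact (S m) = log_fact m + ln (INR m + 1)).
{ intros m. unfold log_fact.
  replace (gamma_sum (S m)) with (gamma_sum m + (euler_gamma + ln (INR m + 2))) by (rewrite <- gamma_sum_step; ring).
  rewrite S_INR. replace (INR m + 1 + 1) with (INR m + 2) by ring. ring. }
(* The second difference of [barnes_sum] shows that the increments of [log_barnes] and the values of
   [log_fact] grow alike, so their difference is constant in m; c is its value at m = 0. *)
exists (log_barnes 1 - log_barnes 0 - log_fact 0).
assert (Hb : forall m, log_barnes (S m) = log_barnes m + log_fact m + (log_barnes 1 - log_barnes 0 - log_fact 0)).
{ induction m as [|m IH]; [ring|].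
  assert (E : log_barnes (S (S m)) = 2 * log_barnes (S m) - log_barnes m + ln (INR m + 1)).
  { unfold log_barnes.
    replace (barnes_sum (S (S m))) with (2 * barnes_sum (S m) - barnes_sum m + (1 + euler_gamma + ln (INR m + 1)))
      by (rewrite <- barnes_sum_step2; ring).
    rewrite !S_INR. field. }
  rewrite E, Hf. lra. }
intros m Hm. unfold log_ratio. rewrite Hb, Hf, S_INR. unfold barnes_step. field.
Qed.

(** * Complex logarithms and values at the integers *)

Lemma C_ext (z w : C) : Re z = Re w -> Im z = Im w -> z = w.
Proof. destruct z, w; simpl; intros -> ->; reflexivity. Qed.

Lemma Cexp_RtoC x : Cexp (RtoC x) = RtoC (exp x).
Proof. unfold Cexp; simpl. rewrite sin_0, cos_0. apply C_ext; simpl; ring. Qed.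

Lemma Cexp_plus (z w : C) : Cexp (z + w) = (Cexp z * Cexp w)%C.
Proof.
destruct z as [a b], w as [c d]. unfold Cexp; simpl.
rewrite exp_plus, cos_plus, sin_plus. apply C_ext; simpl; ring.
Qed.

Lemma Cmod_Cexp z : Cmod (Cexp z) = exp (Re z).
Proof.
unfold Cexp, Cmod; simpl.
replace (_ + _) with ((exp (Re z)) ^ 2 * ((sin (Im z))² + (cos (Im z))²)) by (unfold Rsqr; ring).
rewrite sin2_cos2, Rmult_1_r. apply sqrt_pow2, Rlt_le, exp_pos.
Qed.

Lemma Cexp_neq_0 z : Cexp z <> 0%C.
Proof. apply Cmod_gt_0. rewrite Cmod_Cexp. apply exp_pos. Qed.

Lemma Carg_RtoC x : 0 < x -> Carg (RtoC x) = 0.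
Proof.
intros Hx. unfold Carg. rewrite Cmod_R, Rabs_right by lra. simpl.
destruct Rlt_dec; [lra|]. replace (x / x) with 1 by (field; lra). apply acos_1.
Qed.

Lemma Clog_RtoC x : 0 < x -> Clog (RtoC x) = RtoC (ln x).
Proof.
intros Hx. unfold Clog. rewrite Carg_RtoC, Cmod_R, Rabs_right by lra. reflexivity.
Qed.

Lemma Cpower_RtoC x y : 0 < x -> Cpower (RtoC x) (RtoC y) = RtoC (exp (y * ln x)).
Proof. intros Hx. unfold Cpower. rewrite Clog_RtoC, <- RtoC_mult by trivial. apply Cexp_RtoC. Qed.

(** [lim] is known only through [complete_cauchy], so its value is found by uniqueness of limits. *)
Lemma Clim_seq_RtoC (f : nat -> C) (g : nat -> R) (l : R) :
  (forall n, f n = RtoC (g n)) -> is_lim_seq g l -> Clim_seq f = RtoC l.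
Proof.
intros Hfg Hg.
assert (Hf : filterlim (U := C_NormedModule) f eventually (locally (RtoC l))).
{ apply filterlim_locally. intros eps. apply is_lim_seq_spec in Hg.
  destruct (Hg eps) as [N HN]. exists N. intros n Hn.
  apply C_NormedModule_mixin_compat1. rewrite Hfg.
  change (Cmod (RtoC (g n) - RtoC l) < eps). rewrite <- RtoC_minus, Cmod_R. apply HN; trivial. }
apply (filterlim_locally_unique (K := C_AbsRing) (V := C_NormedModule) (F := eventually) f); trivial.
apply filterlim_locally. intros eps.
apply (complete_cauchy (T := C_CompleteNormedModule) (filtermap f eventually)).
- apply filtermap_proper_filter, eventually_filter.
- intros e. exists (RtoC l). apply (proj1 (filterlim_locally (U := C_NormedModule) f (RtoC l)) Hf).
Qed.

Lemma Csum1_S (f : nat -> C) n : Csum1 f (S n) = (Csum1 f n + f (S n))%C.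
Proof. unfold Csum1. rewrite sum_n_Sm by lia. reflexivity. Qed.

Lemma Csum1_0 (f : nat -> C) : Csum1 f 0 = 0%C.
Proof. unfold Csum1. rewrite sum_n_m_zero by lia. reflexivity. Qed.

Lemma Barnes_G_nat m : Barnes_G (RtoC (INR m) + 1) = RtoC (exp (log_barnes m)).
Proof.
unfold Barnes_G. cbv zeta.
replace (RtoC (INR m) + 1 - 1)%C with (RtoC (INR m)) by ring.
rewrite (Clim_seq_RtoC _ (fun n => exp (sum1 (barnes_term m) n)) (exp (barnes_sum m))).
- replace (RtoC (INR m) / 2)%C with (RtoC (INR m / 2)) by (rewrite RtoC_div by lra; reflexivity).
  replace (- (RtoC (INR m) + (1 + RtoC euler_gamma) * RtoC (INR m) ^ 2) / 2)%C
    with (RtoC (- (INR m + (1 + euler_gamma) * INR m ^ 2) / 2)).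
  2:{ rewrite RtoC_div, RtoC_opp, RtoC_plus, RtoC_mult, RtoC_plus, RtoC_pow by lra. reflexivity. }
  rewrite Cpower_RtoC, Cexp_RtoC, <- !RtoC_mult, <- !exp_plus.
  + f_equal. f_equal. unfold log_barnes. field.
  + pose proof PI_RGT_0. lra.
- induction n as [|n IH].
  + simpl. rewrite exp_0. reflexivity.
  + change (Cprod1 ?f (S n)) with (Cprod1 f n * f (S n))%C. rewrite IH, sum1_S, exp_plus, RtoC_mult.
    f_equal. unfold barnes_term.
    assert (Hk : INR (S n) <> 0) by (apply not_0_INR; lia).
    assert (Hk0 : 0 < INR (S n)) by (apply lt_0_INR; lia).
    assert (H1 : 0 < 1 + INR m / INR (S n)).
    { assert (0 <= INR m / INR (S n)); [|lra].
      apply Rmult_le_pos; [apply pos_INR|apply Rlt_le, Rinv_0_lt_compat; trivial]. }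
    replace (1 + RtoC (INR m) / RtoC (INR (S n)))%C with (RtoC (1 + INR m / INR (S n))).
    2:{ rewrite RtoC_plus, RtoC_div by trivial. reflexivity. }
    replace (RtoC (INR m) ^ 2 / (2 * RtoC (INR (S n))) - RtoC (INR m))%C
      with (RtoC (INR m ^ 2 / (2 * INR (S n)) - INR m)).
    2:{ rewrite RtoC_minus, RtoC_div, RtoC_mult, RtoC_pow by lra. reflexivity. }
    rewrite Cexp_RtoC, <- RtoC_pow, <- RtoC_mult. f_equal.
    rewrite <- (Rpower_pow (S n)) by trivial. unfold Rpower. rewrite <- exp_plus.
    f_equal. ring.
- apply (is_lim_seq_continuous exp); [|apply is_lim_barnes_sum].
  apply derivable_continuous_pt, derivable_pt_exp.
Qed.

Lemma log_Gamma_nat m : log_Gamma (RtoC (INR m) + 1) = RtoC (log_fact m).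
Proof.
unfold log_Gamma.
replace (RtoC (INR m) + 1)%C with (RtoC (INR (S m))) by (rewrite S_INR, RtoC_plus; reflexivity).
rewrite (Clim_seq_RtoC _ (sum1 (gamma_term m)) (gamma_sum m)).
- rewrite Clog_RtoC by (apply lt_0_INR; lia).
  rewrite <- RtoC_opp, <- RtoC_mult, <- RtoC_minus, <- RtoC_plus.
  unfold log_fact. rewrite S_INR. reflexivity.
- induction n as [|n IH].
  + rewrite Csum1_0. reflexivity.
  + rewrite Csum1_S, IH, sum1_S, RtoC_plus. f_equal.
    assert (Hk : INR (S n) <> 0) by (apply not_0_INR; lia).
    assert (Hk0 : 0 < INR (S n)) by (apply lt_0_INR; lia).
    assert (H1 : 0 < 1 + INR (S m) / INR (S n)).
    { assert (0 < INR (S m) / INR (S n)); [|lra].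
      apply Rdiv_lt_0_compat; trivial. apply lt_0_INR; lia. }
    unfold gamma_term. rewrite <- RtoC_div, <- RtoC_plus, Clog_RtoC, <- RtoC_minus by trivial.
    reflexivity.
- apply is_lim_gamma_sum.
Qed.

Lemma Barnes_ratio_nat m : (1 <= m)%nat ->
  (Barnes_G (RtoC (INR m) + 1) / prefactor (RtoC (INR m)) = glaisher * RtoC (exp (log_ratio m)))%C.
Proof.
intros Hm. assert (Hmp : 0 < INR m) by (apply lt_0_INR; lia).
rewrite Barnes_G_nat. unfold prefactor. rewrite log_Gamma_nat.
replace (- (1 / 2) * RtoC (INR m) ^ 2 - 1 / 2 * RtoC (INR m) - 1 / 12)%C
  with (RtoC (- (1 / 2) * INR m ^ 2 - 1 / 2 * INR m - 1 / 12)).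
2:{ rewrite !RtoC_minus, !RtoC_mult, RtoC_opp, !RtoC_div, RtoC_pow by lra. reflexivity. }
replace (RtoC (INR m) ^ 2 / 4)%C with (RtoC (INR m ^ 2 / 4)).
2:{ rewrite RtoC_div, RtoC_pow by lra. reflexivity. }
rewrite <- RtoC_mult, Cpower_RtoC, !Cexp_RtoC by trivial.
assert (Hg : glaisher <> 0%C) by apply Cexp_neq_0.
set (e1 := log_barnes m). set (e2 := _ * ln (INR m)). set (e3 := INR m ^ 2 / 4).
set (e4 := INR m * log_fact m).
replace (log_ratio m) with (e1 + - (e2 + e3 + e4)) by (unfold log_ratio, e1, e2, e3, e4; field).
rewrite exp_plus, exp_Ropp, !exp_plus.
assert (H : forall e, RtoC (exp e) <> 0%C).
{ intros e He. apply RtoC_inj in He. pose proof (exp_pos e). lra. }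
rewrite RtoC_mult, RtoC_inv, !RtoC_mult.
- field. repeat split; trivial.
- pose proof (exp_pos e2). pose proof (exp_pos e3). pose proof (exp_pos e4).
  apply Rgt_not_eq. repeat apply Rmult_lt_0_compat; trivial.
Qed.

Lemma Cexp_Clog (z : C) : z <> 0%C -> Cexp (Clog z) = z.
Proof.
intros Hz. apply Cmod_gt_0 in Hz.
unfold Cexp, Clog; simpl. rewrite exp_ln by trivial.
set (r := Cmod z) in *.
assert (Hr : r ^ 2 = Re z ^ 2 + Im z ^ 2) by apply Cmod2_alt.
assert (Hx : -1 <= Re z / r <= 1).
{ pose proof (re_le_Cmod z) as H. fold r in H. apply Rabs_le_between in H.
  split; apply Rmult_le_reg_r with r; trivial; unfold Rdiv; rewrite Rmult_assoc, Rinv_l by lra; lra. }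
assert (Hs : sqrt (1 - (Re z / r)²) = Rabs (Im z) / r).
{ replace (1 - (Re z / r)²) with ((Rabs (Im z) / r) ^ 2).
  - apply sqrt_pow2. apply Rmult_le_pos; [apply Rabs_pos|apply Rlt_le, Rinv_0_lt_compat; trivial].
  - unfold Rdiv, Rsqr. rewrite Rpow_mult_distr, pow2_abs.
    replace (Im z ^ 2) with (r ^ 2 - Re z ^ 2) by lra. field. lra. }
unfold Carg. fold r.
destruct Rlt_dec as [Hi|Hi].
- rewrite cos_neg, sin_neg, cos_acos, sin_acos, Hs, Rabs_left by trivial.
  apply C_ext; simpl; field; lra.
- rewrite cos_acos, sin_acos, Hs, Rabs_right by (trivial; lra).
  apply C_ext; simpl; field; lra.
Qed.

(** In the right half-plane |arg z| = atan (|Im z| / Re z), and atan y <= y for y >= 0. This gives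
    the continuity of [Carg] at 1. *)
Lemma Carg_bound z : 0 < Re z -> Rabs (Carg z) <= Rabs (Im z) / Re z.
Proof.
intros Hre.
assert (Hr : 0 < Cmod z).
{ pose proof (re_le_Cmod z) as H. apply Rabs_le_between in H. lra. }
set (r := Cmod z) in *.
assert (Hr2 : r ^ 2 = Re z ^ 2 + Im z ^ 2) by apply Cmod2_alt.
assert (E : acos (Re z / r) = atan (Rabs (Im z) / Re z)).
{ rewrite acos_atan by (apply Rdiv_lt_0_compat; trivial). f_equal.
  replace (1 - (Re z / r)²) with ((Rabs (Im z) / r) ^ 2).
  - rewrite sqrt_pow2; [field; lra|].
    apply Rmult_le_pos; [apply Rabs_pos|apply Rlt_le, Rinv_0_lt_compat; trivial].
  - unfold Rdiv, Rsqr. rewrite Rpow_mult_distr, pow2_abs.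
    replace (Im z ^ 2) with (r ^ 2 - Re z ^ 2) by lra. field. lra. }
replace (Rabs (Carg z)) with (Rabs (atan (Rabs (Im z) / Re z))).
2:{ unfold Carg. fold r. rewrite E. destruct Rlt_dec; [rewrite Rabs_Ropp|]; reflexivity. }
set (y := Rabs (Im z) / Re z).
assert (Hy : 0 <= y) by (apply Rmult_le_pos; [apply Rabs_pos|apply Rlt_le, Rinv_0_lt_compat; trivial]).
assert (H := flat_at_zero atan (fun x => / (1 + x ^ 2)) 1 y 0 ltac:(lra)).
rewrite atan_0 in H. rewrite <- (Rminus_0_r (atan y)).
apply Rle_trans with (1 * y ^ 1); [|lra].
apply H; [| |lra].
- intros x _. auto_derive; trivial. field. nra.
- intros x _. rewrite Rmult_1_l, pow_O. pose proof (pow2_ge_0 x).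
  rewrite Rabs_right by (apply Rle_ge, Rlt_le, Rinv_0_lt_compat; lra).
  rewrite <- Rinv_1. apply Rinv_le_contravar; lra.
Qed.

Lemma is_lim_Clog_1 (W : nat -> C) :
  is_lim_seq (fun m => Re (W m)) 1 -> is_lim_seq (fun m => Im (W m)) 0 ->
  is_lim_seq (fun m => Re (Clog (W m))) 0 /\ is_lim_seq (fun m => Im (Clog (W m))) 0.
Proof.
intros HR HI. split.
- unfold Clog; simpl. rewrite <- ln_1.
  apply (is_lim_seq_continuous ln (fun m => Cmod (W m)) 1).
  + apply derivable_continuous_pt. exists (/ 1). apply derivable_pt_lim_ln; lra.
  + rewrite <- sqrt_1. unfold Cmod.
    apply (is_lim_seq_continuous sqrt (fun m => fst (W m) ^ 2 + snd (W m) ^ 2) 1).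
    * apply continuity_pt_sqrt; lra.
    * assert (L := is_lim_seq_plus' _ _ _ _ (is_lim_seq_mult' _ _ _ _ HR HR) (is_lim_seq_mult' _ _ _ _ HI HI)).
      replace (1 * 1 + 0 * 0) with 1 in L by ring.
      refine (is_lim_seq_ext _ _ _ _ L). intros m. unfold Re, Im. ring.
- apply is_lim_seq_abs_0.
  assert (L := is_lim_seq_div' _ _ _ _ (is_lim_seq_abs _ _ HI) HR R1_neq_R0).
  simpl in L. rewrite Rabs_R0 in L. unfold Rdiv in L. rewrite Rmult_0_l in L.
  apply (is_lim_seq_le_le_loc (fun _ => 0) _ (fun m => Rabs (Im (W m)) * / Re (W m))); trivial.
  + apply is_lim_seq_spec in HR. destruct (HR (mkposreal (1 / 2) ltac:(lra))) as [N HN].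
    exists N. intros m Hm. specialize (HN m Hm). simpl in HN. apply Rabs_lt_between in HN.
    split; [apply Rabs_pos|]. apply Carg_bound. lra.
  + apply is_lim_seq_const.
Qed.

(** * The coefficients of the Barnes expansion *)

(** The expansion variable x = z^(-2) along z = m + 1; the shift keeps it in (0, 1] for every m. *)
Definition inv_sq (m : nat) : R := / INR (S m) ^ 2.

Lemma inv_sq_bounds m : 0 < inv_sq m <= 1.
Proof.
unfold inv_sq. assert (1 <= INR (S m)) by (apply (le_INR 1); lia).
split; [apply Rinv_0_lt_compat, pow_lt; lra|].
rewrite <- Rinv_1. apply Rinv_le_contravar; [lra|]. nra.
Qed.

Lemma is_lim_inv_sq : is_lim_seq inv_sq 0.
Proof.
apply (is_lim_seq_incr_1 (fun m => / INR m ^ 2)). apply is_lim_seq_inv_pow. lia.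
Qed.

Lemma inv_sq_pow m n : inv_sq m ^ n = / INR (S m) ^ (2 * n).
Proof. unfold inv_sq. rewrite pow_inv, <- pow_mult. reflexivity. Qed.

Lemma is_lim_psum (c : nat -> R) n : is_lim_seq (fun m => psum c (S n) (inv_sq m)) (c 0%nat).
Proof.
rewrite <- (psum_0 c n). apply (is_lim_seq_continuous (psum c (S n))); [|apply is_lim_inv_sq].
apply derivable_continuous_pt. eexists. apply is_derive_Reals, is_derive_psum.
Qed.

Lemma is_lim_of_psum (f c : nat -> R) (K : R) n :
  eventually (fun m => Rabs (f m - psum c (S n) (inv_sq m)) <= K * inv_sq m ^ S n) ->
  is_lim_seq f (c 0%nat).
Proof.
intros [N HN].
assert (L : is_lim_seq (fun m => f m - psum c (S n) (inv_sq m)) 0).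
{ apply is_lim_seq_abs_0.
  apply (is_lim_seq_le_le_loc (fun _ => 0) _ (fun m => Rabs K * inv_sq m)).
  - exists N. intros m Hm. split; [apply Rabs_pos|]. eapply Rle_trans; [apply HN; trivial|].
    destruct (inv_sq_bounds m) as [H0 H1].
    apply Rle_trans with (Rabs K * inv_sq m ^ S n).
    + apply Rmult_le_compat_r; [apply pow_le; lra|apply Rle_abs].
    + apply Rmult_le_compat_l; [apply Rabs_pos|]. simpl.
      apply Rle_trans with (inv_sq m * 1); [|lra]. apply Rmult_le_compat_l; [lra|].
      rewrite <- (pow1 n). apply pow_incr; lra.
  - apply is_lim_seq_const.
  - rewrite <- (Rmult_0_r (Rabs K)). apply is_lim_seq_mult'; [apply is_lim_seq_const|apply is_lim_inv_sq]. }
apply (is_lim_seq_ext (fun m => (f m - psum c (S n) (inv_sq m)) + psum c (S n) (inv_sq m))); [intros; ring|].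
rewrite <- (Rplus_0_l (c 0%nat)). apply is_lim_seq_plus'; [exact L|apply is_lim_psum].
Qed.

(** The series has constant term 1 and takes its coefficients from [b] only from index 1 on. *)
Definition re_coeff (b : nat -> C) (n : nat) : R := match n with O => 1 | S _ => Re (b n) end.
Definition im_coeff (b : nat -> C) (n : nat) : R := match n with O => 0 | S _ => Im (b n) end.

Lemma Csum1_psum (b : nat -> C) n m :
  (1 + Csum1 (fun k => b k / RtoC (INR (S m)) ^ (2 * k)) n)%C =
  (psum (re_coeff b) (S n) (inv_sq m), psum (im_coeff b) (S n) (inv_sq m)).
Proof.
induction n as [|n IH].
- rewrite Csum1_0. apply C_ext; simpl; ring.
- rewrite Csum1_S, Cplus_assoc, IH. unfold Cdiv.
  assert (Hm : INR (S m) ^ (2 * S n) <> 0) by (apply pow_nonzero, not_0_INR; lia).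
  rewrite <- RtoC_pow, <- RtoC_inv, <- inv_sq_pow by trivial.
  change (psum ?c (S (S n)) ?x) with (psum c (S n) x + c (S n) * x ^ S n).
  change (re_coeff b (S n)) with (fst (b (S n))). change (im_coeff b (S n)) with (snd (b (S n))).
  set (y := inv_sq m ^ S n). set (P := psum _ _ _). set (Q := psum _ _ _).
  apply C_ext; simpl; ring.
Qed.

Lemma im_le_Cmod (z : C) : Rabs (Im z) <= Cmod z.
Proof. exact (Rle_trans _ _ _ (Rmax_r _ _) (Rmax_Cmod z)). Qed.

Lemma Barnes_expansion_nat (p : C) (b : nat -> C) (n : nat) : Barnes_expansion p b ->
  exists (W : nat -> C) (K : R), eventually (fun m =>
    (glaisher * RtoC (exp (log_ratio (S m))))%C = Cpower (W m) p /\
    Rabs (Re (W m) - psum (re_coeff b) (S n) (inv_sq m)) <= K * inv_sq m ^ S n /\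
    Rabs (Im (W m) - psum (im_coeff b) (S n) (inv_sq m)) <= K * inv_sq m ^ S n).
Proof.
intros hb. pose proof PI2_1.
(* Order [S n] keeps the terms up to index n with an error of order z^(-2(n+1)), that is
   [inv_sq m ^ S n]. Positive reals have argument 0, so the opening [delta] = 1 serves. *)
destruct (hb (S n) 1 ltac:(lia) ltac:(lra)) as [E [K [rho [Hrho HE]]]].
set (z := fun m => RtoC (INR (S m))).
exists (fun m => 1 + Csum1 (fun k => b k / z m ^ (2 * k)) n + E (z m))%C, K.
destruct (INR_unbounded rho) as [N HN]. exists N. intros m Hm.
assert (HmN : INR N <= INR (S m)) by (apply le_INR; lia).
assert (Hm0 : 0 < INR (S m)) by (apply lt_0_INR; lia).
assert (Hz : Cmod (z m) = INR (S m)) by (unfold z; rewrite Cmod_R, Rabs_right; lra).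
destruct (HE (z m)) as [HE1 HE2].
- rewrite Hz. lra.
- unfold z. rewrite Carg_RtoC, Rabs_R0 by trivial. lra.
- rewrite Hz in HE1. unfold Rdiv in HE1. rewrite <- inv_sq_pow in HE1.
  replace (S n - 1)%nat with n in HE2 by lia.
  split; [|split].
  + rewrite <- HE2. unfold z. rewrite Barnes_ratio_nat by lia. reflexivity.
  + unfold z at 1. rewrite Csum1_psum.
    eapply Rle_trans; [|exact HE1]. eapply Rle_trans; [|apply re_le_Cmod].
    apply Req_le. f_equal. unfold Re, Im, Cplus, fst, snd. ring.
  + unfold z at 1. rewrite Csum1_psum.
    eapply Rle_trans; [|exact HE1]. eapply Rle_trans; [|apply im_le_Cmod].
    apply Req_le. f_equal. unfold Re, Im, Cplus, fst, snd. ring.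
Qed.

Lemma is_lim_Re_Im_mult (p : C) (l : nat -> C) :
  is_lim_seq (fun m => Re (l m)) 0 -> is_lim_seq (fun m => Im (l m)) 0 ->
  is_lim_seq (fun m => Re (p * l m)%C) 0 /\ is_lim_seq (fun m => Im (p * l m)%C) 0.
Proof.
intros HR HI.
assert (M : forall s t, is_lim_seq (fun m => s * Re (l m) + t * Im (l m)) 0).
{ intros s t. replace 0 with (s * 0 + t * 0) by ring.
  apply is_lim_seq_plus'; apply is_lim_seq_mult'; trivial; apply is_lim_seq_const. }
split.
- apply (is_lim_seq_ext (fun m => Re p * Re (l m) + - Im p * Im (l m))); [|apply M].
  intros m. simpl. unfold Re, Im. ring.
- apply (is_lim_seq_ext (fun m => Im p * Re (l m) + Re p * Im (l m))); [|apply M].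
  intros m. simpl. unfold Re, Im. ring.
Qed.

(** Here w is the logarithm of [glaisher]. Comparing moduli gives Re w + t m = Re (p Log W), which
    tends to 0. Comparing real parts then gives cos (Im w) = cos (Im (p Log W)), a constant that
    tends to 1, so exp w is a positive real. *)
Lemma Cpower_limit_phase (p w : C) (t : nat -> R) (W : nat -> C) :
  is_lim_seq (fun m => Re (W m)) 1 -> is_lim_seq (fun m => Im (W m)) 0 ->
  eventually (fun m => (Cexp w * RtoC (exp (t m)))%C = Cpower (W m) p) ->
  is_lim_seq (fun m => Re w + t m) 0 /\ Cexp w = RtoC (exp (Re w)).
Proof.
intros HR HI Hev. destruct (is_lim_Clog_1 W HR HI) as [LR LI].
destruct (is_lim_Re_Im_mult p _ LR LI) as [PR PI].
assert (Hev' : eventually (fun m => Re (p * Clog (W m))%C = Re w + t m /\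
  cos (Im (p * Clog (W m))%C) = cos (Im w))).
{ revert Hev. apply filter_imp. intros m E. unfold Cpower in E.
  rewrite <- Cexp_RtoC, <- Cexp_plus in E.
  assert (E1 := f_equal Cmod E). rewrite !Cmod_Cexp in E1. apply exp_inv in E1. simpl in E1.
  split; [symmetry; exact E1|].
  assert (E3 : exp (Re (w + t m)%C) * cos (Im (w + t m)%C) =
    exp (Re (p * Clog (W m))%C) * cos (Im (p * Clog (W m))%C)) by exact (f_equal Re E).
  replace (Im (w + t m)%C) with (Im w) in E3 by (simpl; unfold Im; ring).
  replace (Re (p * Clog (W m))%C) with (Re (w + t m)%C) in E3 by exact E1.
  apply Rmult_eq_reg_l in E3; [symmetry; exact E3|]. apply Rgt_not_eq, exp_pos. }
split.
- refine (is_lim_seq_ext_loc _ _ _ _ PR). revert Hev'. apply filter_imp. intros m [E _]. exact E.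
- assert (L : is_lim_seq (fun m => cos (Im (p * Clog (W m))%C)) (cos 0)).
  { apply (is_lim_seq_continuous cos); trivial. apply continuity_cos. }
  assert (L2 : is_lim_seq (fun _ => cos (Im w)) (cos 0)).
  { refine (is_lim_seq_ext_loc _ _ _ _ L). revert Hev'. apply filter_imp. intros m [_ E]. exact E. }
  apply is_lim_seq_unique in L2. rewrite Lim_seq_const, cos_0 in L2. injection L2 as L2.
  assert (Hs : sin (Im w) = 0).
  { pose proof (sin2_cos2 (Im w)) as H. rewrite L2 in H. unfold Rsqr in H. nra. }
  unfold Cexp. rewrite L2, Hs. apply C_ext; simpl; ring.
Qed.

(* Both sides of [Cpower W p = exp h] are near 1, so no multiple of 2 pi i enters
   when logarithms are taken. *)
Lemma Cpower_inverse_near_1 (p q : C) (h : nat -> R) (W : nat -> C) : (p * q)%C = 1%C ->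
  is_lim_seq (fun m => Re (W m)) 1 -> is_lim_seq (fun m => Im (W m)) 0 ->
  eventually (fun m => RtoC (exp (h m)) = Cpower (W m) p) ->
  eventually (fun m => Re (W m) = exp (Re q * h m) * cos (Im q * h m) /\
                       Im (W m) = exp (Re q * h m) * sin (Im q * h m)).
Proof.
intros Hpq HR HI Hev. destruct (is_lim_Clog_1 W HR HI) as [LR LI].
destruct (is_lim_Re_Im_mult p _ LR LI) as [_ PI].
apply is_lim_seq_spec in PI. specialize (PI (mkposreal 1 Rlt_0_1)).
apply is_lim_seq_spec in HR. specialize (HR (mkposreal 1 Rlt_0_1)).
generalize (filter_and _ _ Hev (filter_and _ _ PI HR)). apply filter_imp.
clear Hev PI HR. intros m [E [HP HRm]]. simpl in HP, HRm. rewrite Rminus_0_r in HP.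
set (l := (p * Clog (W m))%C) in *.
assert (E0 : RtoC (exp (h m)) = Cexp l) by exact E.
assert (E1 := f_equal Cmod E0). rewrite <- Cexp_RtoC, !Cmod_Cexp in E1. apply exp_inv in E1.
assert (E2 := f_equal Im E0). simpl in E2.
assert (E3 := f_equal Re E0). simpl in E3. simpl in E1. rewrite <- E1 in E2, E3.
pose proof (exp_pos (h m)) as He.
assert (Hs : sin (Im l) = 0).
{ symmetry in E2. apply Rmult_integral in E2. destruct E2; trivial; lra. }
assert (Hl : Im l = 0).
{ pose proof PI2_1. change (Rabs (Im l) < 1) in HP. apply Rabs_lt_between in HP.
  destruct (Rtotal_order (Im l) 0) as [H1|[H1|H1]]; trivial.
  - pose proof (sin_gt_0 (- Im l)) as H2. rewrite sin_neg in H2. lra.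
  - pose proof (sin_gt_0 (Im l)) as H2. lra. }
assert (El : l = RtoC (h m)) by (apply C_ext; [symmetry; exact E1|exact Hl]).
assert (HW : W m <> RtoC 0).
{ intros H. rewrite H in HRm. simpl in HRm. apply Rabs_lt_between in HRm. lra. }
assert (EW : W m = Cexp (q * RtoC (h m))).
{ rewrite <- (Cexp_Clog (W m) HW) at 1. f_equal. rewrite <- El. unfold l.
  rewrite Cmult_assoc, (Cmult_comm q p), Hpq. ring. }
rewrite EW. unfold Cexp.
replace (Re (q * RtoC (h m))%C) with (Re q * h m) by (simpl; unfold Re, Im; ring).
replace (Im (q * RtoC (h m))%C) with (Im q * h m) by (simpl; unfold Re, Im; ring).
split; reflexivity.
Qed.

Definition log_coeff (n : nat) : R := match n with O => 0 | S _ => barnes_coeff n end.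

Lemma log_ratio_expansion (g : R) : is_lim_seq (fun m => g + log_ratio (S m)) 0 ->
  forall n, exists C, eventually (fun m =>
  Rabs (g + log_ratio (S m) - psum log_coeff (S n) (inv_sq m)) <= C * inv_sq m ^ S n).
Proof.
intros Hlim.
assert (H0 : is_lim_seq (fun m => g + log_ratio m) 0) by (apply is_lim_seq_incr_1; exact Hlim).
destruct log_ratio_step as [c Hc].
assert (Hc0 : c = 0).
{ assert (L1 : is_lim_seq (fun m => barnes_step (INR m)) 0).
  { apply is_lim_seq_abs_0.
    apply (is_lim_seq_le_le_loc (fun _ => 0) _ (fun m => 2 / INR m)).
    - exists 1%nat. intros m Hm. split; [apply Rabs_pos|].
      (* With M = 0 the expansion is empty and the bound reads 2 / m. *)
      pose proof (barnes_step_expansion 0 (INR m) (lt_0_INR m ltac:(lia))) as B.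
      simpl in B. rewrite Rminus_0_r, !Rmult_1_r in B. exact B.
    - apply is_lim_seq_const.
    - apply is_lim_seq_div_INR. }
  assert (L2 := is_lim_seq_minus' _ _ _ _ (is_lim_seq_minus' _ _ _ _ Hlim H0) L1).
  assert (L3 : is_lim_seq (fun _ => c) (0 - 0 - 0)).
  { refine (is_lim_seq_ext_loc _ _ _ _ L2). exists 1%nat. intros m Hm.
    pose proof (Hc m Hm). lra. }
  apply is_lim_seq_unique in L3. rewrite Lim_seq_const in L3. injection L3 as L3. lra. }
assert (Hstep : forall m, (1 <= m)%nat ->
  g + log_ratio (S m) - (g + log_ratio m) = barnes_step (INR m)).
{ intros m Hm. pose proof (Hc m Hm). lra. }
intros n.
(* That lemma bounds the error after the term of index M by x^M only. Taking M = n + 1 gives the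
   order x^(n+1), and the extra term of index n + 1 is moved into the error. *)
destruct (barnes_expansion_of_step _ H0 Hstep (S n) ltac:(lia)) as [C HC].
exists (C + Rabs (barnes_coeff (S n))). exists 0%nat. intros m _.
specialize (HC (S m) ltac:(lia)).
assert (E : forall M, sum1 (fun i => barnes_coeff i / INR (S m) ^ (2 * i)) M
  = psum log_coeff (S M) (inv_sq m)).
{ induction M as [|M IH]; [simpl; ring|]. rewrite sum1_S, IH.
  change (psum log_coeff (S (S M)) (inv_sq m)) with
    (psum log_coeff (S M) (inv_sq m) + log_coeff (S M) * inv_sq m ^ S M).
  rewrite inv_sq_pow. reflexivity. }
rewrite E in HC. unfold Rdiv in HC. rewrite <- inv_sq_pow in HC.
change (psum log_coeff (S (S n)) (inv_sq m)) with
    (psum log_coeff (S n) (inv_sq m) + barnes_coeff (S n) * inv_sq m ^ S n) in HC.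
set (T := barnes_coeff (S n) * inv_sq m ^ S n) in *.
match goal with |- Rabs (?a - ?b) <= _ => replace (a - b) with ((a - (b + T)) + T) by ring end.
eapply Rle_trans; [apply Rabs_triang|]. rewrite Rmult_plus_distr_r.
apply Rplus_le_compat; trivial. unfold T. rewrite Rabs_mult.
rewrite (Rabs_right (_ ^ _)); [lra|]. apply Rle_ge, pow_le. pose proof (inv_sq_bounds m). lra.
Qed.

Lemma Barnes_expansion_recurrence (p q : C) (b : nat -> C) : (p * q)%C = 1%C ->
  Barnes_expansion p b ->
  forall n, exp_recurrence (Re q) (Im q) log_coeff (re_coeff b) (im_coeff b) n.
Proof.
intros Hpq hb.
(* The error function, hence [W], depends on the order n, so the limits of [W] are established for
   each n separately; order 0 suffices for the phase of [glaisher]. *)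
assert (HW : forall n, exists (W : nat -> C) (K : R),
  is_lim_seq (fun m => Re (W m)) 1 /\ is_lim_seq (fun m => Im (W m)) 0 /\ eventually (fun m =>
    (glaisher * RtoC (exp (log_ratio (S m))))%C = Cpower (W m) p /\
    Rabs (Re (W m) - psum (re_coeff b) (S n) (inv_sq m)) <= K * inv_sq m ^ S n /\
    Rabs (Im (W m) - psum (im_coeff b) (S n) (inv_sq m)) <= K * inv_sq m ^ S n)).
{ intros n. destruct (Barnes_expansion_nat p b n hb) as [W [K HK]].
  exists W, K. split; [|split; trivial].
  - apply (is_lim_of_psum _ (re_coeff b) K n). revert HK. apply filter_imp. tauto.
  - apply (is_lim_of_psum _ (im_coeff b) K n). revert HK. apply filter_imp. tauto. }
set (w := (1 / 12 - C_derive zeta (- (1)))%C).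
assert (Hg : is_lim_seq (fun m => Re w + log_ratio (S m)) 0 /\ Cexp w = RtoC (exp (Re w))).
{ destruct (HW 0%nat) as [W [K [HR [HI HK]]]].
  apply (Cpower_limit_phase p w (fun m => log_ratio (S m)) W HR HI).
  revert HK. apply filter_imp. intros m [E _]. exact E. }
destruct Hg as [Hlim Hphase].
apply (exp_asymptotic_coeffs inv_sq (fun m => Re w + log_ratio (S m))); trivial.
- apply inv_sq_bounds.
- apply is_lim_inv_sq.
- apply log_ratio_expansion; trivial.
- intros n. destruct (HW n) as [W [K [HR [HI HK]]]]. exists K.
  assert (Hinv := Cpower_inverse_near_1 p q (fun m => Re w + log_ratio (S m)) W Hpq HR HI).
  lapply Hinv; [clear Hinv; intros Hinv|].
  + generalize (filter_and _ _ Hinv HK). apply filter_imp.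
    intros m [[E1 E2] [_ [B1 B2]]]. rewrite <- E1, <- E2. split; trivial.
  + revert HK. apply filter_imp. intros m [E _]. rewrite <- E.
    change glaisher with (Cexp w). rewrite Hphase, exp_plus, RtoC_mult. reflexivity.
Qed.

Lemma Cmod_le_Rabs (z : C) : Cmod z <= Rabs (Re z) + Rabs (Im z).
Proof.
pose proof (Rabs_pos (Re z)). pose proof (Rabs_pos (Im z)).
apply Rsqr_incr_0; [|apply Cmod_ge_0|lra]. unfold Rsqr.
replace (Cmod z * Cmod z) with (Cmod z ^ 2) by ring.
rewrite Cmod2_alt, <- (pow2_abs (Re z)), <- (pow2_abs (Im z)). nra.
Qed.

Open Scope C_scope.

Theorem theorem1p3 (theta kappa : C) (r : R) (b : nat -> C)
  (htheta : theta <> 0) (hr : r <> 0%R) (hden : theta * r + kappa <> 0)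
  (hb : Barnes_expansion (1 / (theta * r + kappa)) b) :
  is_equiv (K := C_AbsRing) (V := C_NormedModule) eventually b
    (fun n => (- (1)) ^ n
       * (2 * (theta * r + kappa) * INR (fact (2 * n - 1)))
       / RtoC (2 * PI) ^ (2 * n + 2)).
Proof.
set (q := theta * r + kappa) in *.
assert (Hpq : 1 / q * q = 1) by (field; exact hden).
pose proof (Barnes_expansion_recurrence _ q b Hpq hb) as Hrec.
destruct (exp_recurrence_growth (Re q) (Im q) 4 log_coeff (re_coeff b) (im_coeff b))
  as [K [HK Hb]]; trivial; try lra.
{ intros [|j] Hj; [lia|]. apply barnes_coeff_bound; lia. }
pose proof PI_RGT_0 as HPI.
assert (HPI2 : (0 < (2 * PI) ^ 2)%R) by (apply pow_lt; lra).
assert (Hq : (0 < Cmod q)%R) by (apply Cmod_gt_0; exact hden).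
set (g := fun n => ((-1) ^ n * (2 * INR (fact (2 * n - 1))) / (2 * PI) ^ (2 * n + 2))%R).
set (G := fun n => (2 * growth n / (2 * PI) ^ 2)%R).
assert (HG : forall n, (0 < G n)%R).
{ intros n. pose proof (growth_pos n). apply Rdiv_lt_0_compat; lra. }
assert (Hg : forall n, Rabs (g n) = G n).
{ intros n. pose proof (INR_fact_lt_0 (2 * n - 1)) as Hf. unfold g, G, growth, Rdiv.
  rewrite !Rabs_mult, pow_1_abs, (Rabs_right 2), (Rabs_right (INR _)), (Rabs_right (/ _)%R) by
    first [lra | apply Rle_ge, Rlt_le, Rinv_0_lt_compat, pow_lt; lra].
  rewrite pow_add. field. repeat split; try apply pow_nonzero; lra. }
assert (Et : forall n, (- (1)) ^ n * (2 * q * INR (fact (2 * n - 1))) / RtoC (2 * PI) ^ (2 * n + 2)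
  = q * RtoC (g n)).
{ intros n. unfold g.
  assert (((2 * PI) ^ (2 * n + 2))%R <> 0%R) by (apply pow_nonzero; lra).
  rewrite RtoC_div, !RtoC_mult, !RtoC_pow by trivial.
  replace (RtoC (-1)) with (- (1)) by (apply C_ext; simpl; ring).
  assert (RtoC (2 * PI) ^ (2 * n + 2) <> 0).
  { rewrite <- RtoC_pow. intros H1. apply RtoC_inj in H1. contradiction. }
  rewrite <- RtoC_mult. field. trivial. }
(* Total error in units of [G n]: |q| 4^(-n) from the frequencies k >= 2, and K (2 pi)^2 / n from
   the convolution, where two real errors K [growth n] / n are rewritten through [growth n] = (2
   pi)^2 [G n] / 2. *)
assert (Herr : is_lim_seq (fun n => (Cmod q * (/ 4) ^ n + K * (2 * PI) ^ 2 / INR n)%R) 0%R).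
{ replace 0%R with (Cmod q * 0 + 0)%R by ring. apply is_lim_seq_plus'.
  - apply is_lim_seq_mult'; [apply is_lim_seq_const|]. apply is_lim_seq_geom.
    rewrite Rabs_right; lra.
  - apply is_lim_seq_div_INR. }
intros eps. apply is_lim_seq_spec in Herr.
destruct (Herr (mkposreal (eps * Cmod q) (Rmult_lt_0_compat _ _ (cond_pos eps) Hq))) as [N HN].
exists (S N). intros n Hn. rewrite Et.
change (Cmod (q * RtoC (g n) - b n) <= eps * Cmod (q * RtoC (g n)))%R.
rewrite Cmod_mult, Cmod_R, Hg.
specialize (HN n ltac:(lia)). rewrite Rminus_0_r in HN. simpl pos in HN.
apply Rabs_lt_between in HN.
destruct n as [|n]; [lia|]. destruct (Hb (S n) ltac:(lia)) as [B1 B2].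
pose proof (barnes_coeff_approx (S n)) as A. fold (g (S n)) (G (S n)) in A.
assert (HSn : (0 < INR (S n))%R) by (apply lt_0_INR; lia).
apply Rle_trans with ((Cmod q * (/ 4) ^ (S n) + K * (2 * PI) ^ 2 / INR (S n)) * G (S n))%R.
2:{ replace (eps * (Cmod q * G (S n)))%R with (eps * Cmod q * G (S n))%R by ring.
    apply Rmult_le_compat_r; [apply Rlt_le, HG|lra]. }
(* The exact coefficient q a_n is inserted between the claimed equivalent and b_n. *)
replace (q * RtoC (g (S n)) - b (S n)) with
  (q * RtoC (g (S n) - barnes_coeff (S n)) + (q * RtoC (barnes_coeff (S n)) - b (S n))).
2:{ rewrite RtoC_minus. ring. }
eapply Rle_trans; [apply Cmod_triangle|]. rewrite Rmult_plus_distr_r.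
apply Rplus_le_compat.
- rewrite Cmod_mult, Cmod_R, Rmult_assoc, Rabs_minus_sym.
  apply Rmult_le_compat_l; [lra|exact A].
- eapply Rle_trans; [apply Cmod_le_Rabs|].
  replace (K * (2 * PI) ^ 2 / INR (S n) * G (S n))%R with
    (K * growth (S n) / INR (S n) + K * growth (S n) / INR (S n))%R.
  2:{ unfold G. field. lra. }
  apply Rplus_le_compat.
  + rewrite <- Rabs_Ropp. eapply Rle_trans; [|exact B1]. apply Req_le. f_equal.
    simpl. unfold Re, Im. ring.
  + rewrite <- Rabs_Ropp. eapply Rle_trans; [|exact B2]. apply Req_le. f_equal.
    simpl. unfold Re, Im. ring.
Qed.
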